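(* Let $N\ge1$, let $\mathbf{z}=(z_1>\cdots>z_N)$ be a fixed top row, and let $\mathsf{a}=(\mathsf{a}_1,\ldots,\mathsf{a}_N)\in\mathbb{R}^N$ be fixed. For $\beta>0$ let $\{y_i^k(\beta)\}_{1\le i\le k\le N}$ be the perturbed $\beta$-corners process with scaled perturbation $a_i=\frac{\beta}{2}\mathsf{a}_i$, $i=1,\ldots,N$, and fixed top row $\mathbf{z}$. Let $\{\bar{\mathsf{y}}_i^k\}_{1\le i\le k\le N}$ be the deformed $\infty$-corners lattice with top row $\mathbf{z}$ and parameters $\mathsf{a}$. Then, as $\beta\to\infty$, for all $1\le i\le k\le N$, $$y_i^k(\beta)\to\bar{\mathsf{y}}_i^k\qquad\text{in probability}.$$
   Context: Interlacing: for $\mathbf{u}=(u_1\ge\cdots\ge u_k)$ and $\mathbf{w}=(w_1\ge\cdots\ge w_{k+1})$, $\mathbf{u}\prec\mathbf{w}$ means $w_1\ge u_1\ge w_2\ge\cdots\ge u_k\ge w_{k+1}$. Perturbed $\beta$-corners process with perturbation $\mathbf{a}=(a_1,\ldots,a_N)$ and fixed top row $\mathbf{z}$: a random array with levels $\mathbf{y}^k=(y_1^k\ge\cdots\ge y_k^k)$, $k=1,\ldots,N$, with $\mathbf{y}^N=\mathbf{z}$ deterministic, whose lower levels $\mathbf{Y}=(\mathbf{y}^1,\ldots,\mathbf{y}^{N-1})$ have the probability density (with respect to Lebesgue measure on $\mathbb{R}^{N(N-1)/2}$) proportional, as a function of $\mathbf{Y}$, to $$\mathbf{1}_{\mathbf{y}^1\prec\cdots\prec\mathbf{y}^{N-1}\prec\mathbf{z}}\prod_{k=1}^{N-1}\Bigl(\prod_{1\le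 i<j\le k}(y_i^k-y_j^k)^{2-\beta}\prod_{p=1}^k\prod_{q=1}^{k+1}|y_p^k-y_q^{k+1}|^{\beta/2-1}\Bigr)\exp\Bigl[\sum_{k=1}^{N-1}\sum_{i=1}^k y_i^k(a_k-a_{k+1})\Bigr].$$ (This is the conditional density of $\mathbf{Y}$ given the top row in the perturbed Gaussian $\beta$-corners process.) Deformed $\infty$-corners lattice with top row $\mathbf{z}$ and parameters $\mathsf{a}$: $\bar{\mathsf{y}}_i^N=z_i$ for $i=1,\ldots,N$, and $\{\bar{\mathsf{y}}_i^k\}_{1\le i\le k\le N-1}$ is the unique solution of the coupled equations $$\sum_{\substack{1\le j\le k\\ j\ne i}}\frac{1}{\bar{\mathsf{y}}_i^k-\bar{\mathsf{y}}_j^k}-\frac12\sum_{q=1}^{k+1}\frac{1}{\bar{\mathsf{y}}_i^k-\bar{\mathsf{y}}_q^{k+1}}-\frac12\sum_{p=1}^{k-1}\frac{1}{\bar{\mathsf{y}}_i^k-\bar{\mathsf{y}}_p^{k-1}}=\frac{\mathsf{a}_k-\mathsf{a}_{k+1}}{2},\qquad 1\le i\le k\le N-1,$$ subject to strict interlacing: $\bar{\mathsf{y}}^k\prec\bar{\mathsf{y}}^{k+1}$ with $\bar{\mathsf{y}}_i^k\ne\bar{\mathsf{y}}_j^{k+1}$ for all $1\le k\le N-1$, $1\le i\le k$, $1\le j\le k+1$. (Existence and uniqueness hold for every such $\mathbf{z}$, $\mathsf{a}$.) *)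

(* Defs.v *)
From HB Require Import structures.
From mathcomp Require Import all_boot all_order all_algebra.
From mathcomp Require Import all_classical all_reals all_analysis.

Set Implicit Arguments.
Unset Strict Implicit.
Unset Printing Implicit Defensive.

Import Order.TTheory GRing.Theory Num.Theory.
Import numFieldNormedType.Exports.

Local Open Scope classical_set_scope.
Local Open Scope ring_scope.

Section tuple_measure.
Context {d : measure_display} {T : measurableType d} {R : realType}.
Variable m : {sigma_finite_measure set T -> \bar R}.

Definition cons_tuple_pair n (p : T * n.-tuple T) : n.+1.-tuple T :=
  [the n.+1.-tuple T of p.1 :: p.2].

Lemma measurable_cons_tuple_pair n :
  measurable_fun setT (@cons_tuple_pair n).
Proof. exact: measurable_cons. Qed.

Section step.
Variables (n : nat) (mu : {sigma_finite_measure set (n.-tuple T) -> \bar R}).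

Definition tuple_measure_step : set (n.+1.-tuple T) -> \bar R :=
  pushforward (m \x mu)%E (@cons_tuple_pair n).

Let step0 : tuple_measure_step set0 = 0%E.
Proof. by rewrite /tuple_measure_step /pushforward preimage_set0 measure0. Qed.

Let step_ge0 A : (0 <= tuple_measure_step A)%E.
Proof. by rewrite /tuple_measure_step /pushforward measure_ge0. Qed.

Let step_sigma_additive : semi_sigma_additive tuple_measure_step.
Proof.
have mcons (B : set (n.+1.-tuple T)) : measurable B ->
    measurable (@cons_tuple_pair n @^-1` B).
  by move=> mB; rewrite -[X in measurable X]setTI;
    exact: measurable_cons_tuple_pair.
move=> F mF tF mUF; rewrite /tuple_measure_step /pushforward preimage_bigcup.
apply: measure_semi_sigma_additive.
- by move=> k; exact: mcons.
- apply/trivIsetP => /= i j _ _ ij; rewrite -preimage_setI.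
  by move/trivIsetP : tF => /(_ _ _ _ _ ij) ->//; rewrite preimage_set0.
- by rewrite -preimage_bigcup; exact: mcons.
Qed.

HB.instance Definition _ := isMeasure.Build _ _ _
  tuple_measure_step step0 step_ge0 step_sigma_additive.

Let step_sigma_finite : sigma_finite setT tuple_measure_step.
Proof.
have /sigma_finiteP[F [TF ndF Foo]] := sigma_finiteT m.
have /sigma_finiteP[G [TG ndG Goo]] := sigma_finiteT mu.
pose unc (t : n.+1.-tuple T) : T * n.-tuple T :=
  (thead t, [tuple of behead t]).
have consK p : unc (cons_tuple_pair p) = p.
  by case: p => x t; congr pair; apply/val_inj.
have munc : measurable_fun setT unc.
  apply/measurable_fun_pair; last exact: measurable_behead.
  exact: measurable_tnth.
exists (fun k => unc @^-1` (F k `*` G k)).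
  rewrite -preimage_bigcup -[LHS](preimage_setT unc); congr preimage.
  apply/esym/seteqP; split=> // -[x t] _.
  have [i _ Fix] : (\bigcup_i F i) x by rewrite -TF.
  have [j _ Gjt] : (\bigcup_i G i) t by rewrite -TG.
  exists (maxn i j) => //; split => /=.
  - by move: x Fix; exact/subsetPset/ndF/leq_maxl.
  - by move: t Gjt; exact/subsetPset/ndG/leq_maxr.
move=> k; have [mF Fkoo] := Foo k; have [mG Gkoo] := Goo k; split.
  by rewrite -[X in measurable X]setTI; apply: munc => //; exact: measurableX.
rewrite /tuple_measure_step /pushforward -comp_preimage.
rewrite (_ : unc \o _ = id); last by apply/funext => p /=.
by rewrite preimage_id product_measure1E// lte_mul_pinfty// ge0_fin_numE.
Qed.

HB.instance Definition _ := Measure_isSigmaFinite.Build _ _ _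
  tuple_measure_step step_sigma_finite.

End step.

(* n-fold product of m, characterized by tuple_measure_box. *)
Fixpoint tuple_measure n : {sigma_finite_measure set (n.-tuple T) -> \bar R} :=
  if n is k.+1 then tuple_measure_step (tuple_measure k)
  else dirac ([tuple] : 0.-tuple T).

Lemma tuple_measure_box n (A : 'I_n -> set T) :
  (forall i, measurable (A i)) ->
  tuple_measure n [set t | forall i, A i (tnth t i)] =
  (\prod_(i < n) m (A i))%E.
Proof.
elim: n A => [|n IHn] A mA.
  by rewrite big_ord0 /= diracE mem_set //= => -[].
rewrite big_ord_recl -IHn //= /tuple_measure_step /pushforward.
rewrite -product_measure1E //; last first.
  rewrite (_ : mkset _ =
      \bigcap_(i in [set: 'I_n]) ((fun t => tnth t i) @^-1` A (lift ord0 i))).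
    apply: fin_bigcap_measurable => // i _.
    rewrite -[X in measurable X]setTI.
    exact: measurable_tnth.
  by apply/seteqP; split=> t /= h i; [move=> _|]; exact: h.
congr (product_measure1 _ _ _); apply/seteqP; split=> -[x t] /=.
  move=> h; split; first exact: (h ord0).
  by move=> i; have := h (lift ord0 i); rewrite tnthS.
move=> [h0 h] i; case: (unliftP ord0 i) => [j|] ->; last exact: h0.
by rewrite tnthS.
Qed.

End tuple_measure.

Definition lebesgue_tuple (R : realType) (n : nat) :
    {sigma_finite_measure set (n.-tuple (measurableTypeR R)) -> \bar R} :=
  tuple_measure (@lebesgue_measure R) n.

Section corners.
Context {R : realType}.

(* Rows and arrays are indexed from 1: entry v i is the i-th coordinate v_i of
   v, 1 <= i <= n, and an array y has entries y k i, 1 <= i <= k <= N; other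
   values are irrelevant. *)
Definition entry n (v : n.-tuple R) (i : nat) : R := nth 0 v i.-1.

(* u = (u_1, .., u_k) interlaces with w = (w_1, .., w_(k+1)). *)
Definition interlace (k : nat) (u w : nat -> R) : Prop :=
  forall i, (1 <= i <= k)%N -> w i.+1 <= u i <= w i.

(* The array with top row z and lower levels Y. A point Y of R^(N(N-1)/2) lists
   y^1, .., y^(N-1) in this order, so that level k starts after
   1 + .. + (k-1) = 'C(k, 2) coordinates. *)
Definition corners_array N (z : N.-tuple R)
    (Y : 'C(N, 2).-tuple (measurableTypeR R)) (k i : nat) : R :=
  if k == N then entry z i else entry (Y : 'C(N, 2).-tuple R) ('C(k, 2) + i).

Definition interlacing_arrays N (z : N.-tuple R) :
    set ('C(N, 2).-tuple (measurableTypeR R)) :=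
  [set Y | forall k, (1 <= k < N)%N ->
    interlace k (corners_array z Y k) (corners_array z Y k.+1)].

(* Unnormalized density. The values of powR at base 0 only matter on a
   Lebesgue-null set. *)
Definition corners_weight N (beta : R) (a z : N.-tuple R)
    (Y : 'C(N, 2).-tuple (measurableTypeR R)) : R :=
  let y := corners_array z Y in
  \1_(interlacing_arrays z) Y *
  (\prod_(1 <= k < N)
    ((\prod_(1 <= i < k.+1) \prod_(i.+1 <= j < k.+1)
        (y k i - y k j) `^ (2 - beta)) *
     (\prod_(1 <= p < k.+1) \prod_(1 <= q < k.+2)
        `|y k p - y k.+1 q| `^ (beta / 2 - 1)))) *
  expR (\sum_(1 <= k < N) \sum_(1 <= i < k.+1)
          y k i * (entry a k - entry a k.+1)).

(* The lower levels Y of the perturbed beta-corners process with perturbation a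
   and top row z; the whole process is corners_array z (Y w). The constant c is
   forced to be the inverse of the integral of the weight since the law of Y has
   total mass 1. *)
Definition perturbed_corners N (beta : R) (a z : N.-tuple R)
    (d : measure_display) (T : measurableType d) (P : probability T R)
    (Y : {RV P >-> 'C(N, 2).-tuple (measurableTypeR R)}) : Prop :=
  exists c : R, forall A, measurable A ->
    distribution P Y A =
    (\int[lebesgue_tuple R 'C(N, 2)]_(x in A)
       (c * corners_weight beta a z x)%:E)%E.

Definition infty_corners N (a z : N.-tuple R) (y : nat -> nat -> R) : Prop :=
  [/\ forall i, (1 <= i <= N)%N -> y N i = entry z i,
      forall k, (1 <= k < N)%N ->
        interlace k (y k) (y k.+1) /\
        forall i j, (1 <= i <= k)%N -> (1 <= j <= k.+1)%N ->
          y k i <> y k.+1 j &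
      forall k i, (1 <= i <= k)%N -> (k < N)%N ->
        \sum_(1 <= j < k.+1 | j != i) (y k i - y k j)^-1
        - 2^-1 * \sum_(1 <= q < k.+2) (y k i - y k.+1 q)^-1
        - 2^-1 * \sum_(1 <= p < k) (y k i - y k.-1 p)^-1
        = (entry a k - entry a k.+1) / 2].

(* X b --> l in probability as b --> +oo; the X b may live on different
   probability spaces. *)
Definition cvg_in_probability (d : R -> measure_display)
    (T : forall b, measurableType (d b)) (P : forall b, probability (T b) R)
    (X : forall b, T b -> R) (l : R) : Prop :=
  forall eps : R, 0 < eps ->
    P b [set w | eps < `|X b w - l|] @[b --> +oo] --> 0%E.

End corners.

(* Main.v *)
Require Import Defs.
From HB Require Import structures.
From mathcomp Require Import all_boot all_order all_algebra.
From mathcomp Require Import all_classical all_reals all_analysis.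
From mathcomp Require Import measurable_realfun.
From mathcomp Require Import ring lra zify.
Import Order.TTheory GRing.Theory Num.Theory.
Import numFieldNormedType.Exports.
Set Implicit Arguments.
Unset Strict Implicit.
Unset Printing Implicit Defensive.
Local Open Scope classical_set_scope.
Local Open Scope ring_scope.

(** Write C_k for the sum of ln |y^k_p - y^{k+1}_q| over all p, q, and S_k for
the sum of ln |y^k_i - y^k_j| over all ordered pairs i <> j. On strictly
interlacing arrays the unnormalized density is exp ((beta/2) L + G), where L is
the sum over the levels of C_k - S_k plus the linear term coming from the
perturbation, and G is the sum of S_k - C_k; for beta > 2 the density vanishes
elsewhere. The equations of the deformed lattice say that ybar is a critical
point of L, so the limit is an instance of Laplace's method, and the point is to
prove that ybar is a well separated global maximum of L.

The reason is a tangent inequality for two consecutive rows u, w. Put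
  c_q = prod_p (w_q - u_p) / prod_{j <> q} (w_q - w_j),
  b_p = - prod_q (u_p - w_q) / prod_{j <> p} (u_p - u_j),
  P_pq = b_p c_q / (u_p - w_q)^2.
Lagrange interpolation shows that the c_q are positive with sum 1 and that P,
completed by the row c, is doubly stochastic ([sum_top_weight],
[sum_coupling_bot], [sum_coupling_top]). The product of all b_p and c_q is the
square of the product of all |u_p - w_q| divided by the product of all u_i - u_j
and w_i - w_j with i < j. The logarithms of these ratios, summed over the
levels, give the nonlinear part of L up to a constant depending on the top row
([log_density_telescope]). Gibbs' inequality between the stochastic matrices of
two interlacing pairs bounds the increment of the logarithm of this ratio, from
a reference pair to any other pair, by the sum of P_pq ln t_pq, where P is the
matrix of the reference pair and t_pq is the quotient of the two values of
u_p - w_q ([energy_le]).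

Summing over the levels, L(y) - L(ybar) is at most the sum of P_pq ln t_pq plus
the increment of the linear term. Both sides vanish at y = ybar, so an
inequality between them forces equal derivatives there, and these are zero by
criticality ([coupling_tangent]): the sum of P_pq (t_pq - 1) cancels the linear
increment. What remains is the sum of P_pq (ln t_pq - (t_pq - 1)), whose terms
are at most 0, with an explicit negative bound as soon as some entry of y is at
distance more than eps from ybar, because the top row is fixed
([log_density_gap]).

For the probabilities, beta = 4 serves as a reference. Far from ybar the
density for beta is at most exp ((beta/2 - 2) (L(ybar) - delta)) times the one
for 4, which integrates to a finite constant because it is normalizable; on a
small box around ybar L is at least L(ybar) - delta/2, which bounds the
normalizing constant from above. The probability of a deviation therefore
decays exponentially in beta ([deviation_le]). *)

(** * Lagrange interpolation *)

Lemma size_prod_XsubC_neq (F : fieldType) (I : eqType) (r : seq I) (x : I -> F)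
    (i : I) :
  uniq r -> i \in r ->
  size (\prod_(j <- r | j != i) ('X - (x j)%:P)) = size r.
Proof.
move=> ur ri; rewrite -big_filter size_prod_XsubC.
have -> : [seq j <- r | j != i] = rem i r by rewrite rem_filter.
by rewrite size_rem// prednK//; case: (r) ri.
Qed.

(** The left-hand side is the coefficient of top degree in Lagrange's formula
for the polynomial interpolating h at the nodes, which is h itself. *)
Lemma lagrange_sum (F : fieldType) (I : eqType) (r : seq I) (x : I -> F)
    (h : {poly F}) :
  uniq r -> {in r &, injective x} -> (size h <= size r)%N ->
  \sum_(i <- r) h.[x i] / \prod_(j <- r | j != i) (x i - x j) =
  h`_(size r).-1.
Proof.
move=> ur xinj hr.
have ux : uniq (map x r) by rewrite map_inj_in_uniq.
pose l i : {poly F} := \prod_(j <- r | j != i) ('X - (x j)%:P).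
have size_l i : i \in r -> size (l i) = size r.
  exact: size_prod_XsubC_neq.
pose p := \sum_(i <- r) (h.[x i] / \prod_(j <- r | j != i) (x i - x j)) *: l i.
suff ph : p = h.
  rewrite -[in RHS]ph /p coef_sum big_seq [RHS]big_seq; apply: eq_bigr => i ri.
  rewrite coefZ -(size_l i ri) (_ : _`__ = lead_coef (l i))//.
  have /monicP -> : l i \is monic by apply: monic_prod_XsubC.
  by rewrite mulr1.
apply/eqP; rewrite -subr_eq0; apply/eqP.
apply: (@roots_geq_poly_eq0 _ _ (map x r)) => //; last first.
  rewrite size_map (leq_trans (size_polyD _ _))// size_polyN geq_max hr andbT.
  rewrite /p big_seq; apply: (big_ind (fun q : {poly F} => (size q <= size r)%N)).
  - by rewrite size_poly0.
  - by move=> a b ha hb; rewrite (leq_trans (size_polyD _ _))// geq_max ha hb.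
  - by move=> i ri; rewrite (leq_trans (size_scale_leq _ _))// size_l.
apply/allP => _ /mapP[i ri ->]; rewrite /root hornerD hornerN subr_eq0; apply/eqP.
have neq0 j : j \in r -> \prod_(m <- r | m != j) (x j - x m) != 0.
  move=> rj; rewrite prodf_seq_neq0; apply/allP => m rm; apply/implyP => mj.
  by rewrite subr_eq0; apply: contra mj => /eqP e; apply/eqP/xinj.
have evall j : (l j).[x i] = \prod_(m <- r | m != j) (x i - x m).
  by rewrite horner_prod; apply: eq_bigr => m _; rewrite hornerXsubC.
rewrite /p horner_sum (bigD1_seq i)//= [X in _ + X]big1_seq ?addr0; last first.
  move=> j /andP[ji rj]; rewrite hornerZ evall; apply/eqP.
  rewrite mulf_eq0 prodf_seq_eq0; apply/orP; right; apply/hasP; exists i => //.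
  by rewrite eq_sym ji subrr eqxx.
by rewrite hornerZ evall divfK// neq0.
Qed.

(** [lagrange_sum] with one node singled out: the double poles in the coupling
matrix below come from adding an entry of one row to the nodes of the other. *)
Lemma divided_difference (F : fieldType) n (x0 : F) (v : nat -> F)
    (h : {poly F}) :
  (forall i j, (1 <= i <= n)%N -> (1 <= j <= n)%N -> v i = v j -> i = j) ->
  (forall i, (1 <= i <= n)%N -> v i != x0) -> (size h <= n.+1)%N ->
  \sum_(1 <= i < n.+1)
     h.[v i] / ((v i - x0) * \prod_(1 <= j < n.+1 | j != i) (v i - v j)) +
  h.[x0] / \prod_(1 <= j < n.+1) (x0 - v j) = h`_n.
Proof.
move=> vinj vx0 hn; pose x i := if i is 0%N then x0 else v i.
have xE i : (0 < i)%N -> x i = v i by case: i.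
have mem1 i : i \in index_iota 1 n.+1 -> (1 <= i <= n)%N.
  by rewrite mem_index_iota ltnS.
have r0 : index_iota 0 n.+1 = 0%N :: index_iota 1 n.+1.
  by rewrite /index_iota subn0 subn1.
have xinj : {in index_iota 0 n.+1 &, injective x}.
  move=> i j; rewrite !mem_index_iota /= => hi hj.
  case: i j hi hj => [|i] [|j]//= hi hj e.
  - by have /eqP := vx0 j.+1 hj; rewrite e.
  - by have /eqP := vx0 i.+1 hi; rewrite e.
  - exact: vinj.
have hs : size (index_iota 0 n.+1) = n.+1 by rewrite size_iota subn0.
have ur : uniq (index_iota 0 n.+1) by exact: iota_uniq.
have := lagrange_sum ur xinj; rewrite hs => /(_ h hn) e.
rewrite -[RHS]e {e} r0 big_cons addrC; congr (_ / _ + _).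
- rewrite big_cons eqxx /= [LHS]big_seq_cond [RHS]big_seq_cond.
  apply: eq_big => [i|i /andP[/mem1/andP[i0 _] _]]; last by rewrite xE.
  rewrite andbT; case: (boolP (_ \in _)) => //= /mem1 /andP[i0 _].
  by rewrite -lt0n i0.
- rewrite [LHS]big_seq [RHS]big_seq; apply: eq_bigr => i /mem1/andP[i0 _].
  rewrite xE// big_cons eq_sym -lt0n i0; congr (_ / (_ * _)).
  rewrite [LHS]big_seq_cond [RHS]big_seq_cond.
  by apply: eq_bigr => j /andP[/mem1/andP[j0 _] _]; rewrite xE.
Qed.

(** * The coupling matrix of two interlacing rows *)

Definition strict_interlace (R : realType) k (u w : nat -> R) :=
  forall i, (1 <= i <= k)%N -> w i.+1 < u i < w i.

Section two_rows.
Context {R : realType}.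
Implicit Types (k : nat) (u w : nat -> R).

(** The residues of prod_p (x - u_p) / prod_q (x - w_q) at its poles; those of
the reciprocal function are, up to sign, the [bot_weight]. *)
Definition top_weight k u w q : R :=
  (\prod_(1 <= p < k.+1) (w q - u p)) /
  \prod_(1 <= j < k.+2 | j != q) (w q - w j).

Definition bot_weight k u w p : R :=
  - (\prod_(1 <= q < k.+2) (u p - w q)) /
  \prod_(1 <= j < k.+1 | j != p) (u p - u j).

(** The squared entries of the orthogonal matrix which relates the eigenbasis of
a symmetric matrix with spectrum w to the one of a corner with spectrum u. *)
Definition coupling k u w p q : R :=
  bot_weight k u w p * top_weight k u w q / (u p - w q) ^+ 2.

Lemma strict_interlace_lt_top k u w i j : strict_interlace k u w ->
  (1 <= i)%N -> (i < j)%N -> (j <= k.+1)%N -> w j < w i.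
Proof.
move=> uw i1; elim: j => // j IH; rewrite ltnS leq_eqVlt => /predU1P[<-|ij] jk.
  have /andP[h1 h2] := uw i ltac:(lia); exact: lt_trans h1 h2.
have /andP[h1 h2] := uw j ltac:(lia).
by apply: lt_trans (IH ij _); [exact: lt_trans h1 h2|lia].
Qed.

Lemma strict_interlace_lt_cross k u w p q : strict_interlace k u w ->
  (1 <= p <= k)%N -> (p < q)%N -> (q <= k.+1)%N -> w q < u p.
Proof.
move=> uw pk pq qk; have /andP[h1 h2] := uw p pk.
move: pq; rewrite leq_eqVlt => /predU1P[<-//|pq].
by apply: lt_trans h1; apply: (strict_interlace_lt_top uw).
Qed.

Lemma strict_interlace_gt_cross k u w p q : strict_interlace k u w ->
  (1 <= p <= k)%N -> (1 <= q)%N -> (q <= p)%N -> u p < w q.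
Proof.
move=> uw pk q1 qp; have /andP[h1 h2] := uw p pk.
move: qp; rewrite leq_eqVlt => /predU1P[->//|qp].
by apply: (lt_trans h2); apply: (strict_interlace_lt_top uw) => //; lia.
Qed.

Lemma strict_interlace_lt_bot k u w i j : strict_interlace k u w ->
  (1 <= i)%N -> (i < j)%N -> (j <= k)%N -> u j < u i.
Proof.
move=> uw i1 ij jk.
apply: (@lt_trans _ _ (w j)).
  by apply: (strict_interlace_gt_cross uw) => //; lia.
by apply: (strict_interlace_lt_cross uw) => //; lia.
Qed.

Section weights.
Variables (k : nat) (u w : nat -> R).
Hypothesis uw : strict_interlace k u w.

Lemma top_neq i j : (1 <= i <= k.+1)%N -> (1 <= j <= k.+1)%N -> i != j ->
  w i != w j.
Proof.
move=> ik jk; rewrite neq_ltn => /orP[] ij.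
  by rewrite gt_eqF// (strict_interlace_lt_top uw)//; lia.
by rewrite lt_eqF// (strict_interlace_lt_top uw)//; lia.
Qed.

Lemma bot_neq i j : (1 <= i <= k)%N -> (1 <= j <= k)%N -> i != j ->
  u i != u j.
Proof.
move=> ik jk; rewrite neq_ltn => /orP[] ij.
  by rewrite gt_eqF// (strict_interlace_lt_bot uw)//; lia.
by rewrite lt_eqF// (strict_interlace_lt_bot uw)//; lia.
Qed.

Lemma cross_neq p q : (1 <= p <= k)%N -> (1 <= q <= k.+1)%N -> u p != w q.
Proof.
move=> pk qk; have [pq|qp] := ltnP p q.
  by rewrite gt_eqF// (strict_interlace_lt_cross uw)//; lia.
by rewrite lt_eqF// (strict_interlace_gt_cross uw)//; lia.
Qed.

(** The factors of numerator and denominator are paired so that each quotient is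
positive: u_p with w_p for p < q, and u_p with w_(p+1) for p >= q. *)
Lemma top_weight_gt0 q : (1 <= q <= k.+1)%N -> 0 < top_weight k u w q.
Proof.
move=> /andP[q1 qk]; rewrite /top_weight.
have -> : \prod_(1 <= j < k.+2 | j != q) (w q - w j) =
  (\prod_(1 <= j < q) (w q - w j)) * \prod_(q <= j < k.+1) (w q - w j.+1).
  rewrite (@big_cat_nat _ _ _ q)//= ?ltnS//; last lia.
  rewrite [X in _ * X]big_ltn_cond ?ltnS//= eqxx/=; congr (_ * _).
    rewrite [LHS]big_seq_cond [RHS]big_seq; apply: eq_bigl => j.
    by rewrite mem_index_iota; case: (ltngtP j q); rewrite ?andbF ?andbT.
  rewrite big_add1 /= [LHS]big_seq_cond [RHS]big_seq; apply: eq_bigl => j.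
  rewrite mem_index_iota; case: (ltngtP j.+1 q); rewrite ?andbF ?andbT//; lia.
rewrite (@big_cat_nat _ _ _ q)//= invfM mulrACA -!prodf_div.
apply: mulr_gt0; rewrite big_seq; apply: prodr_gt0 => j;
  rewrite mem_index_iota => jq.
- rewrite -mulrNN -invrN !opprB divr_gt0// subr_gt0.
    by apply: (strict_interlace_lt_cross uw); lia.
  by apply: (strict_interlace_lt_top uw); lia.
- rewrite divr_gt0// subr_gt0.
    by apply: (strict_interlace_gt_cross uw); lia.
  by apply: (strict_interlace_lt_top uw); lia.
Qed.

Lemma sum_top_weight : \sum_(1 <= q < k.+2) top_weight k u w q = 1.
Proof.
have hs : size (index_iota 1 k.+2) = k.+1 by rewrite size_iota subn1.
have winj : {in index_iota 1 k.+2 &, injective w}.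
  move=> i j; rewrite !mem_index_iota !ltnS => hi hj /eqP.
  by apply: contraTeq => ij; exact: top_neq.
pose h : {poly R} := \prod_(1 <= p < k.+1) ('X - (u p)%:P).
have hh : size h = k.+1 by rewrite size_prod_XsubC size_iota subn1.
have := lagrange_sum (iota_uniq _ _ : uniq (index_iota 1 k.+2)) winj.
rewrite hs => /(_ h); rewrite hh => /(_ (leqnn _)) e.
transitivity (h`_k); last first.
  have /monicP <- : h \is monic by apply: monic_prod_XsubC.
  by rewrite /lead_coef hh.
rewrite -[RHS]e; apply: eq_bigr => q _; congr (_ / _).
by rewrite horner_prod; apply: eq_bigr => p _; rewrite hornerXsubC.
Qed.

(** Interpolation at the nodes w_1, .., w_(k+1), u_p of a polynomial of degree
k - 1, whose coefficient of degree k + 1 vanishes. It also yields the sign of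
[bot_weight] from the one of [top_weight]. *)
Lemma sum_top_weight_div p : (1 <= p <= k)%N ->
  \sum_(1 <= q < k.+2) top_weight k u w q / (u p - w q) ^+ 2 =
  (bot_weight k u w p)^-1.
Proof.
move=> pk; pose h : {poly R} := \prod_(1 <= j < k.+1 | j != p) ('X - (u j)%:P).
have pr : p \in index_iota 1 k.+1 by rewrite mem_index_iota ltnS.
have hh : size h = k.
  by rewrite size_prod_XsubC_neq ?iota_uniq// size_iota subn1.
have hE y : h.[y] = \prod_(1 <= j < k.+1 | j != p) (y - u j).
  by rewrite horner_prod; apply: eq_bigr => j _; rewrite hornerXsubC.
have := @divided_difference R k.+1 (u p) w h; rewrite hh.
have -> : h`_k.+1 = 0 by rewrite nth_default// hh.
move=> /(_ _ _ (leqW (leqW (leqnn _))))/eqP.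
rewrite addr_eq0 => /(_ _ _)/eqP e.
transitivity (- (h.[u p] / \prod_(1 <= j < k.+2) (u p - w j))); last first.
  by rewrite /bot_weight hE invfM invrN mulNr invrK mulrC.
rewrite -e; last 2 first.
- move=> i j hi hj /eqP; apply: contraTeq => ij; exact: top_neq.
- by move=> i hi; rewrite eq_sym; exact: cross_neq.
rewrite [LHS]big_seq [RHS]big_seq; apply: eq_bigr => q.
rewrite mem_index_iota ltnS => qk.
rewrite /top_weight (bigD1_seq p pr (iota_uniq _ _))/= hE.
have up : u p - w q != 0 by rewrite subr_eq0 cross_neq.
have wu : w q - u p != 0 by rewrite subr_eq0 eq_sym cross_neq.
rewrite [in RHS]invfM; move: (\prod_(1 <= j < k.+2 | j != q) _)^-1 => Di.
by move: (\prod_(_ <= _ < _ | _) _) => H; field; rewrite ?up ?wu.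
Qed.

Lemma bot_weight_gt0 p : (1 <= p <= k)%N -> 0 < bot_weight k u w p.
Proof.
move=> pk; rewrite -invr_gt0 -sum_top_weight_div//.
rewrite big_nat_recl//; apply: ltr_wpDr.
  rewrite big_seq; apply: sumr_ge0 => q; rewrite mem_index_iota => qk.
  by rewrite divr_ge0 ?sqr_ge0// ltW// top_weight_gt0//; lia.
rewrite divr_gt0 ?top_weight_gt0// exprn_even_gt0//= subr_eq0.
by rewrite cross_neq.
Qed.

Lemma sum_coupling_bot p : (1 <= p <= k)%N ->
  \sum_(1 <= q < k.+2) coupling k u w p q = 1.
Proof.
move=> pk; rewrite /coupling; under eq_bigr do rewrite -mulrA.
by rewrite -big_distrr/= sum_top_weight_div// divff// gt_eqF// bot_weight_gt0.
Qed.

(** Interpolation at the nodes u_1, .., u_k, w_q of a monic polynomial of degree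
k. The row of the [top_weight] completes these column sums to 1. *)
Lemma sum_coupling_top q : (1 <= q <= k.+1)%N ->
  \sum_(1 <= p < k.+1) coupling k u w p q = 1 - top_weight k u w q.
Proof.
move=> qk; pose h : {poly R} := \prod_(1 <= j < k.+2 | j != q) ('X - (w j)%:P).
have qr : q \in index_iota 1 k.+2 by rewrite mem_index_iota ltnS.
have hh : size h = k.+1.
  by rewrite size_prod_XsubC_neq ?iota_uniq// size_iota subn1.
have hE y : h.[y] = \prod_(1 <= j < k.+2 | j != q) (y - w j).
  by rewrite horner_prod; apply: eq_bigr => j _; rewrite hornerXsubC.
have := @divided_difference R k (w q) u h; rewrite hh.
have -> : h`_k = 1.
  have /monicP <- : h \is monic by apply: monic_prod_XsubC.
  by rewrite /lead_coef hh.
move=> /(_ _ _ (leqnn _)) e.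
have t0 : top_weight k u w q != 0 by rewrite gt_eqF// top_weight_gt0.
suff -> : \sum_(1 <= p < k.+1) coupling k u w p q =
  - (top_weight k u w q *
    \sum_(1 <= i < k.+1) h.[u i] /
     ((u i - w q) * \prod_(1 <= j < k.+1 | j != i) (u i - u j))).
  have -> : \sum_(1 <= i < k.+1) h.[u i] /
     ((u i - w q) * \prod_(1 <= j < k.+1 | j != i) (u i - u j)) =
     1 - (top_weight k u w q)^-1; last by rewrite mulrBr mulr1 divff// opprB.
  rewrite /top_weight invf_div -hE; apply/eqP; rewrite -subr_eq opprK e//.
  by move=> i j hi hj /eqP; apply: contraTeq => ij; exact: bot_neq.
  by move=> i hi; exact: cross_neq.
rewrite big_distrr/= -sumrN [LHS]big_seq [RHS]big_seq; apply: eq_bigr => p.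
rewrite mem_index_iota ltnS => pk.
rewrite /coupling /bot_weight (bigD1_seq q qr (iota_uniq _ _))/= hE.
have up : u p - w q != 0 by rewrite subr_eq0 cross_neq.
rewrite [in RHS]invfM; move: (\prod_(1 <= j < k.+1 | j != p) _)^-1 => Di.
by move: (\prod_(_ <= _ < _ | _) _) => H; field.
Qed.

End weights.
End two_rows.

(** * Gibbs' inequality between interlacing pairs *)

Definition cross_log (R : realType) k (u w : nat -> R) :=
  \sum_(1 <= p < k.+1) \sum_(1 <= q < k.+2) ln `|u p - w q|.

Definition self_log (R : realType) k (u : nat -> R) :=
  \sum_(1 <= i < k.+1) \sum_(1 <= j < k.+1 | j != i) ln `|u i - u j|.

Lemma ln_norm_prod (R : realType) (I : eqType) (r : seq I) (P : pred I)
    (F : I -> R) : (forall i, i \in r -> P i -> F i != 0) ->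
  ln `|\prod_(i <- r | P i) F i| = \sum_(i <- r | P i) ln `|F i|.
Proof.
elim: r => [|i r IH] F0; first by rewrite !big_nil normr1 ln1.
have {}IH := IH (fun j jr => F0 j (mem_behead (s := i :: r) jr)).
rewrite !big_cons; case: ifP => // Pi; rewrite normrM lnM ?IH// posrE normr_gt0.
  by rewrite F0// mem_head.
rewrite prodf_seq_neq0; apply/allP => j jr; apply/implyP => Pj.
by rewrite F0// inE jr orbT.
Qed.

(** Pointwise form of the nonnegativity of relative entropy: between families
of equal total mass the right-hand sides cancel in the sum. *)
Lemma gibbs_term (R : realType) (a b : R) : 0 < a -> 0 < b ->
  a * (ln b - ln a) <= b - a.
Proof.
move=> a0 b0; rewrite -ln_div//.
have : ln (1 + (b / a - 1)) <= b / a - 1.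
  by apply: le_ln1Dx; rewrite ltrBDr addrC subrr divr_gt0.
rewrite addrC subrK => h.
have -> : b - a = a * (b / a - 1) by field; rewrite gt_eqF.
by rewrite ler_pM2l.
Qed.

Section energy.
Context {R : realType}.
Implicit Types (k : nat) (u v w x : nat -> R).

Lemma sum_ln_weights k u w : strict_interlace k u w ->
  \sum_(1 <= p < k.+1) ln (bot_weight k u w p) +
  \sum_(1 <= q < k.+2) ln (top_weight k u w q) =
  2 * cross_log k u w - self_log k u - self_log k.+1 w.
Proof.
move=> uw.
have mem m i : i \in index_iota 1 m.+1 -> (1 <= i <= m)%N.
  by rewrite mem_index_iota ltnS.
have -> : \sum_(1 <= p < k.+1) ln (bot_weight k u w p) =
    cross_log k u w - self_log k u.
  rewrite /cross_log /self_log -sumrB [LHS]big_seq [RHS]big_seq.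
  apply: eq_bigr => p /mem pk.
  have u0 j : j \in index_iota 1 k.+1 -> j != p -> u p - u j != 0.
    by move=> /mem jk jp; rewrite subr_eq0 (bot_neq uw)// eq_sym.
  have w0 q : q \in index_iota 1 k.+2 -> true -> u p - w q != 0.
    by move=> /mem qk _; rewrite subr_eq0 (cross_neq uw).
  have := bot_weight_gt0 uw pk => b0.
  rewrite -(gtr0_norm b0) /bot_weight normrM normfV normrN ln_div ?posrE.
  - by rewrite !ln_norm_prod.
  - rewrite normr_gt0 prodf_seq_neq0; apply/allP => q qk; exact/implyP/w0.
  - rewrite normr_gt0 prodf_seq_neq0; apply/allP => q qk; exact/implyP/u0.
have -> : \sum_(1 <= q < k.+2) ln (top_weight k u w q) =
    cross_log k u w - self_log k.+1 w.
  rewrite /cross_log /self_log exchange_big/= -sumrB [LHS]big_seq [RHS]big_seq.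
  apply: eq_bigr => q /mem qk.
  have w0 j : j \in index_iota 1 k.+2 -> j != q -> w q - w j != 0.
    by move=> /mem jk jq; rewrite subr_eq0 (top_neq uw)// eq_sym.
  have u0 p : p \in index_iota 1 k.+1 -> true -> w q - u p != 0.
    by move=> /mem pk _; rewrite subr_eq0 eq_sym (cross_neq uw).
  have := top_weight_gt0 uw qk => c0.
  rewrite -(gtr0_norm c0) /top_weight normrM normfV ln_div ?posrE.
  - rewrite !ln_norm_prod//; congr (_ - _).
    by apply: eq_bigr => p _; rewrite distrC.
  - rewrite normr_gt0 prodf_seq_neq0; apply/allP => p pk; exact/implyP/u0.
  - rewrite normr_gt0 prodf_seq_neq0; apply/allP => j jk; exact/implyP/w0.
ring.
Qed.

Lemma coupling_gt0 k u w p q : strict_interlace k u w ->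
  (1 <= p <= k)%N -> (1 <= q <= k.+1)%N -> 0 < coupling k u w p q.
Proof.
move=> uw pk qk; rewrite /coupling divr_gt0//.
  by rewrite mulr_gt0 ?(bot_weight_gt0 uw)// (top_weight_gt0 uw).
by rewrite exprn_even_gt0//= subr_eq0 (cross_neq uw).
Qed.

(** Relative entropy is nonnegative for the matrix P completed by the row c. The
logarithm of an entry of P splits into a part depending on p, a part depending
on q and - 2 ln |u_p - w_q|; by double stochasticity the first two parts average
to the sums of the logarithms of the weights, whatever the reference pair is. *)
Lemma energy_le k u w v x : strict_interlace k u w -> strict_interlace k v x ->
  (2 * cross_log k u w - self_log k u - self_log k.+1 w) -
  (2 * cross_log k v x - self_log k v - self_log k.+1 x) <=
  2 * \sum_(1 <= p < k.+1) \sum_(1 <= q < k.+2)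
        coupling k v x p q * (ln `|u p - w q| - ln `|v p - x q|).
Proof.
move=> uw vx; rewrite -!sum_ln_weights//.
have mem m i : i \in index_iota 1 m.+1 -> (1 <= i <= m)%N.
  by rewrite mem_index_iota ltnS.
pose b p := ln (bot_weight k u w p) - ln (bot_weight k v x p).
pose c q := ln (top_weight k u w q) - ln (top_weight k v x q).
pose t p q := ln `|u p - w q| - ln `|v p - x q|.
have hP : \sum_(1 <= p < k.+1) \sum_(1 <= q < k.+2)
    coupling k v x p q * (b p + c q - 2 * t p q) <= 0.
  rewrite [leRHS](_ : _ = \sum_(1 <= p < k.+1) \sum_(1 <= q < k.+2)
      (coupling k u w p q - coupling k v x p q)); last first.
    rewrite big_seq big1// => p /mem pk.
    by rewrite sumrB !sum_coupling_bot// subrr.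
  apply: ler_sum_nat => p; rewrite ltnS => pk.
  apply: ler_sum_nat => q; rewrite ltnS => qk.
  have := gibbs_term (coupling_gt0 vx pk qk) (coupling_gt0 uw pk qk).
  congr (_ * _ <= _).
  have lnc y z : strict_interlace k y z -> ln (coupling k y z p q) =
     ln (bot_weight k y z p) + ln (top_weight k y z q) - 2 * ln `|y p - z q|.
    move=> yz; have d0 : 0 < `|y p - z q|.
      by rewrite normr_gt0 subr_eq0 (cross_neq yz).
    rewrite /coupling -real_normK ?num_real// ln_div ?posrE ?exprn_gt0//.
      rewrite lnM ?posrE ?(bot_weight_gt0 yz)// ?(top_weight_gt0 yz)//.
      by rewrite lnXn// mulr_natl.
    by rewrite mulr_gt0// ?(bot_weight_gt0 yz)// (top_weight_gt0 yz).
  by rewrite !lnc// /b /c /t; ring.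
have hc : \sum_(1 <= q < k.+2) top_weight k v x q * c q <= 0.
  rewrite [leRHS](_ : _ =
    \sum_(1 <= q < k.+2) (top_weight k u w q - top_weight k v x q)); last first.
    by rewrite sumrB !sum_top_weight// subrr.
  apply: ler_sum_nat => q; rewrite ltnS => qk.
  exact: gibbs_term (top_weight_gt0 vx qk) (top_weight_gt0 uw qk).
(* Double stochasticity: the rows of the reference coupling sum to 1 and its
   columns to 1 minus the top weight. *)
have split : \sum_(1 <= p < k.+1) \sum_(1 <= q < k.+2)
    coupling k v x p q * (b p + c q - 2 * t p q) =
  \sum_(1 <= p < k.+1) b p +
  \sum_(1 <= q < k.+2) (c q - top_weight k v x q * c q) -
  2 * \sum_(1 <= p < k.+1) \sum_(1 <= q < k.+2) coupling k v x p q * t p q.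
  have -> : \sum_(1 <= p < k.+1) b p =
      \sum_(1 <= p < k.+1) \sum_(1 <= q < k.+2) coupling k v x p q * b p.
    rewrite [LHS]big_seq [RHS]big_seq; apply: eq_bigr => p /mem pk.
    by rewrite -big_distrl/= sum_coupling_bot// mul1r.
  have -> : \sum_(1 <= q < k.+2) (c q - top_weight k v x q * c q) =
      \sum_(1 <= p < k.+1) \sum_(1 <= q < k.+2) coupling k v x p q * c q.
    rewrite exchange_big/= [LHS]big_seq [RHS]big_seq; apply: eq_bigr => q /mem qk.
    by rewrite -big_distrl/= sum_coupling_top// mulrBl mul1r.
  rewrite big_distrr/= -big_split -sumrB; apply: eq_bigr => p _.
  rewrite big_distrr/= -big_split -sumrB; apply: eq_bigr => q _ /=.
  ring.
have bE : \sum_(1 <= p < k.+1) b p = \sum_(1 <= p < k.+1) ln (bot_weight k u w p)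
  - \sum_(1 <= p < k.+1) ln (bot_weight k v x p) by rewrite -sumrB.
have cE : \sum_(1 <= q < k.+2) (c q - top_weight k v x q * c q) =
  \sum_(1 <= q < k.+2) ln (top_weight k u w q)
  - \sum_(1 <= q < k.+2) ln (top_weight k v x q)
  - \sum_(1 <= q < k.+2) top_weight k v x q * c q by rewrite -!sumrB.
move: hP; rewrite split bE cE /t; lra.
Qed.

End energy.

(** * Triangular arrays *)

Section arrays.
Context {R : realType}.
Implicit Types (N k : nat) (y v : nat -> nat -> R) (d : nat -> R).

Lemma triangle_lower_bound n (f : nat -> nat -> R) :
  (forall k i, (1 <= i <= k)%N -> (k <= n)%N -> 0 < f k i) ->
  exists2 g, 0 < g & forall k i, (1 <= i <= k)%N -> (k <= n)%N -> g <= f k i.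
Proof.
move=> f0.
have lower (s : seq (nat * nat)) : (forall j, j \in s -> 0 < f j.1 j.2) ->
    exists2 g, 0 < g & forall j, j \in s -> g <= f j.1 j.2.
  elim: s => [_|j0 s IH s0]; first by exists 1.
  have [j js|g g0 gs] := IH; first by rewrite s0// inE js orbT.
  exists (Num.min g (f j0.1 j0.2)); first by rewrite lt_min g0 s0// mem_head.
  by move=> j; rewrite inE => /predU1P[->|/gs]; rewrite ge_min ?lexx ?orbT// => ->.
have [|g g0 gf] := lower [seq (k, i) | k <- iota 0 n.+1, i <- iota 1 k].
  move=> _ /allpairsPdep[k [i [+ + ->]]] /=; rewrite !mem_iota => kn ik.
  by apply: f0; lia.
exists g => // k i ik kn; apply: (gf (k, i)).
by apply/allpairsPdep; exists k, i; rewrite !mem_iota; split => //; lia.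
Qed.

Definition strict_array N y :=
  forall k, (1 <= k < N)%N -> strict_interlace k (y k) (y k.+1).

Lemma strict_array_near N y : strict_array N y ->
  exists2 r, 0 < r & forall y',
    (forall k i, (1 <= i <= k)%N -> (k <= N)%N -> `|y' k i - y k i| < r) ->
    strict_array N y'.
Proof.
move=> sy.
pose f k i := if (k < N)%N then
  Num.min (y k i - y k.+1 i.+1) (y k.+1 i - y k i) else 1.
have [k i ik kn|g g0 gf] := @triangle_lower_bound N f.
  rewrite /f; case: ifPn => // kN; have /andP[h1 h2] := sy k ltac:(lia) i ik.
  by rewrite lt_min !subr_gt0 h1 h2.
exists (g / 2); first by rewrite divr_gt0.
move=> y' hy k kN i ik.
have kN' : (k < N)%N by lia.
have := gf k i ik (ltnW kN'); rewrite /f kN'.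
rewrite le_min => /andP[h1 h2].
have := hy k i ik ltac:(lia); have := hy k.+1 i ltac:(lia) ltac:(lia).
have := hy k.+1 i.+1 ltac:(lia) ltac:(lia).
rewrite !ltr_norml => /andP[? ?] /andP[? ?] /andP[? ?].
apply/andP; split; lra.
Qed.

Definition log_density N d y : R :=
  \sum_(1 <= k < N) (cross_log k (y k) (y k.+1) - self_log k (y k)) +
  \sum_(1 <= k < N) \sum_(1 <= i < k.+1) y k i * d k.

(** Each S_k with k < N is shared equally between the pairs of levels
(k - 1, k) and (k, k + 1), which makes every term the energy of two consecutive
rows; S_1 = 0, and the unpaired half of S_N depends on the top row only. *)
Lemma log_density_telescope N d y : (1 <= N)%N ->
  2 * log_density N d y =
  \sum_(1 <= k < N) (2 * cross_log k (y k) (y k.+1) - self_log k (y k)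
     - self_log k.+1 (y k.+1)) + self_log N (y N) +
  2 * \sum_(1 <= k < N) \sum_(1 <= i < k.+1) y k i * d k.
Proof.
move=> N1; rewrite /log_density mulrDr; congr (_ + _).
have -> : self_log N (y N) =
    \sum_(1 <= k < N) (self_log k.+1 (y k.+1) - self_log k (y k)).
  rewrite (telescope_sumr (fun k => self_log k (y k)))//.
  rewrite [X in _ - X](_ : _ = 0) ?subr0//.
  by rewrite /self_log big_nat1 big_ltn_cond//= big_geq.
rewrite -big_split big_distrr/=; apply: eq_bigr => k _; ring.
Qed.

Lemma self_log_eq k (u w : nat -> R) :
  (forall i, (1 <= i <= k)%N -> u i = w i) -> self_log k u = self_log k w.
Proof.
move=> uw; apply: eq_big_nat => i ik.
rewrite big_nat_cond [RHS]big_nat_cond; apply: eq_bigr => j /andP[jk _].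
by rewrite !uw.
Qed.

Definition array_coupling y k := coupling k (y k) (y k.+1).

Lemma log_density_le N d y y' : (1 <= N)%N ->
  strict_array N y -> strict_array N y' ->
  (forall i, (1 <= i <= N)%N -> y' N i = y N i) ->
  log_density N d y' - log_density N d y <=
  \sum_(1 <= k < N) \sum_(1 <= p < k.+1) \sum_(1 <= q < k.+2)
    array_coupling y k p q *
      (ln `|y' k p - y' k.+1 q| - ln `|y k p - y k.+1 q|) +
  \sum_(1 <= k < N) \sum_(1 <= i < k.+1) (y' k i - y k i) * d k.
Proof.
move=> N1 sy sy' yN.
have -> : \sum_(1 <= k < N) \sum_(1 <= i < k.+1) (y' k i - y k i) * d k =
  \sum_(1 <= k < N) \sum_(1 <= i < k.+1) y' k i * d k -
  \sum_(1 <= k < N) \sum_(1 <= i < k.+1) y k i * d k.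
  rewrite -sumrB; apply: eq_bigr => k _; rewrite -sumrB.
  by apply: eq_bigr => i _; rewrite mulrBl.
rewrite -(@ler_pM2l _ 2)// mulrBr !log_density_telescope//.
rewrite (self_log_eq yN).
set A' := \sum_(1 <= k < N) (2 * cross_log k (y' k) (y' k.+1) - _ - _).
set A := \sum_(1 <= k < N) (2 * cross_log k (y k) (y k.+1) - _ - _).
set B := \sum_(1 <= k < N) \sum_(1 <= p < k.+1) \sum_(1 <= q < k.+2) _.
suff : A' - A <= 2 * B by lra.
rewrite /A' /A /B -sumrB big_distrr/=; apply: ler_sum_nat => k kN.
exact: energy_le (sy' k kN) (sy k kN).
Qed.

End arrays.

(** * Criticality *)

Lemma is_derive_sum_nat (R : realType) m n (P : pred nat) (f : nat -> R -> R)
    (l : nat -> R) (t : R) :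
  (forall i, (m <= i < n)%N -> P i -> is_derive t (1 : R) (f i) (l i)) ->
  is_derive t (1 : R) (fun s => \sum_(m <= i < n | P i) f i s)
    (\sum_(m <= i < n | P i) l i).
Proof.
move=> fl.
have {}fl i : i \in index_iota m n -> P i -> is_derive t (1 : R) (f i) (l i).
  by rewrite mem_index_iota; exact: fl.
elim: (index_iota m n) fl => [_|i r IH fl].
  rewrite big_nil (_ : (fun _ => _) = cst 0); first exact: is_derive_cst.
  by apply/funext => s; rewrite big_nil.
have {}IH := IH (fun j jr => fl j (mem_behead (s := i :: r) jr)).
rewrite big_cons; case: ifPn => Pi; last first.
  rewrite (_ : (fun _ => _) = fun s => \sum_(j <- r | P j) f j s)//.
  by apply/funext => s; rewrite big_cons (negbTE Pi).
rewrite (_ : (fun _ => _) = f i + (fun s => \sum_(j <- r | P j) f j s)).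
  by apply: is_deriveD => //; apply: fl => //; rewrite mem_head.
by apply/funext => s; rewrite big_cons Pi.
Qed.

Lemma is_derive_ln_affine (R : realType) (c x t : R) : 0 < 1 + t * x ->
  is_derive t (1 : R) (fun s => c * ln (1 + s * x)) (c * (x / (1 + t * x))).
Proof.
move=> h.
have da : is_derive t (1 : R) (fun s : R => 1 + s * x) x.
  rewrite (_ : (fun s : R => _) = cst 1 + x *: id); last first.
    by apply/funext => s /=; rewrite mulrC.
  by apply: is_derive_eq; rewrite add0r /GRing.scale/= mulr1.
have dl : is_derive (1 + t * x) (1 : R) (@ln R) (1 + t * x)^-1.
  exact: is_derive1_ln.
rewrite (mulrC x).
have H := @is_derive1_comp _ (@ln R) (fun s => 1 + s * x) _ _ _ dl da.
exact: (@is_deriveZ _ _ _ (@ln R \o (fun s => 1 + s * x)) c).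
Qed.

Section tangent.
Context {R : realType}.
Implicit Types (N k : nat) (y v : nat -> nat -> R) (d : nat -> R).

Definition critical N d y := forall k i, (1 <= i <= k)%N -> (k < N)%N ->
  \sum_(1 <= j < k.+1 | j != i) (y k i - y k j)^-1
  - 2^-1 * \sum_(1 <= q < k.+2) (y k i - y k.+1 q)^-1
  - 2^-1 * \sum_(1 <= p < k) (y k i - y k.-1 p)^-1 = d k / 2.

(** The left-hand side is the derivative of the logarithmic density at y in the
direction v; collecting the coefficient of each v^k_i gives the equations. *)
Lemma critical_variation N d y v : (1 <= N)%N -> critical N d y ->
  (forall i, (1 <= i <= N)%N -> v N i = 0) ->
  \sum_(1 <= k < N)
    (\sum_(1 <= p < k.+1) \sum_(1 <= q < k.+2)
       (v k p - v k.+1 q) / (y k p - y k.+1 q) -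
     \sum_(1 <= i < k.+1) \sum_(1 <= j < k.+1 | j != i)
       (v k i - v k j) / (y k i - y k j)) +
  \sum_(1 <= k < N) \sum_(1 <= i < k.+1) v k i * d k = 0.
Proof.
move=> N1 cy vN.
pose up k := \sum_(1 <= i < k.+1) v k i * \sum_(1 <= q < k.+2) (y k i - y k.+1 q)^-1.
pose dn k := \sum_(1 <= i < k.+1) v k i * \sum_(1 <= p < k) (y k i - y k.-1 p)^-1.
pose sl k := \sum_(1 <= i < k.+1) v k i *
  \sum_(1 <= j < k.+1 | j != i) (y k i - y k j)^-1.
have crossE k : \sum_(1 <= p < k.+1) \sum_(1 <= q < k.+2)
    (v k p - v k.+1 q) / (y k p - y k.+1 q) = up k + dn k.+1.
  have -> : dn k.+1 = \sum_(1 <= p < k.+1) \sum_(1 <= q < k.+2)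
      v k.+1 q * (y k.+1 q - y k p)^-1.
    rewrite exchange_big/=; apply: eq_bigr => q _; by rewrite big_distrr.
  rewrite -big_split/=; apply: eq_bigr => p _; rewrite big_distrr/= -big_split/=.
  by apply: eq_bigr => q _; rewrite -(opprB (y k p)) invrN; ring.
have selfE k : \sum_(1 <= i < k.+1) \sum_(1 <= j < k.+1 | j != i)
    (v k i - v k j) / (y k i - y k j) = 2 * sl k.
  have e1 : sl k = \sum_(1 <= i < k.+1) \sum_(1 <= j < k.+1 | j != i)
      v k i / (y k i - y k j).
    by apply: eq_bigr => i _; rewrite big_distrr.
  have e2 : sl k = \sum_(1 <= i < k.+1) \sum_(1 <= j < k.+1 | j != i)
      v k j / (y k j - y k i).
    rewrite e1 (exchange_big_dep predT)//=; apply: eq_bigr => j _.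
    by apply: eq_bigl => i; rewrite eq_sym.
  rewrite mulr2n mulrDl mul1r {1}e1 e2 -big_split/=; apply: eq_bigr => i _.
  rewrite -big_split/=; apply: eq_bigr => j _.
  by rewrite -(opprB (y k i)) invrN; ring.
(* Shifting k to k + 1: the boundary terms vanish since v^N = 0 and level 1 has
   no row below it. *)
have dnE : \sum_(1 <= k < N) dn k.+1 = \sum_(1 <= k < N) dn k.
  apply/eqP; rewrite -subr_eq0 -sumrB telescope_sumr// /dn.
  rewrite [X in X - _]big_nat [X in X - _]big1.
    by rewrite big_nat1 big_geq// mulr0 subrr.
  by move=> i iN; rewrite vN ?mul0r//; lia.
under eq_bigr do rewrite crossE selfE.
have -> : \sum_(1 <= k < N) (up k + dn k.+1 - 2 * sl k) =
    \sum_(1 <= k < N) (up k + dn k - 2 * sl k).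
  by rewrite !sumrB !big_split/= dnE.
rewrite -big_split/= big_nat big1// => k kN.
rewrite /up /dn /sl big_distrr/= -big_split -sumrB -big_split/= big_nat big1//.
move=> i ik; have := cy k i ik ltac:(lia).
set a := \sum_(_ <= _ < _ | _) _; set b := \sum_(_ <= _ < k.+2) _.
set c := \sum_(_ <= _ < k) _ => h.
have -> : d k = 2 * (a - 2^-1 * b - 2^-1 * c) by rewrite h; field.
by field.
Qed.

Lemma cross_ratio_gt0 k (u w u' w' : nat -> R) p q :
  strict_interlace k u w -> strict_interlace k u' w' ->
  (1 <= p <= k)%N -> (1 <= q <= k.+1)%N -> 0 < (u' p - w' q) / (u p - w q).
Proof.
move=> uw uw' pk qk; have [pq|qp] := ltnP p q.
  by rewrite divr_gt0// subr_gt0 (strict_interlace_lt_cross (k := k))//; lia.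
rewrite -mulrNN -invrN !opprB divr_gt0// subr_gt0.
  by apply: (strict_interlace_gt_cross uw') => //; lia.
by apply: (strict_interlace_gt_cross uw) => //; lia.
Qed.

Lemma bot_ratio_gt0 k (u w u' w' : nat -> R) i j :
  strict_interlace k u w -> strict_interlace k u' w' ->
  (1 <= i <= k)%N -> (1 <= j <= k)%N -> j != i -> 0 < (u' i - u' j) / (u i - u j).
Proof.
move=> uw uw' ik jk; rewrite neq_ltn => /orP[ji|ij].
  rewrite -mulrNN -invrN !opprB divr_gt0// subr_gt0.
    by apply: (strict_interlace_lt_bot uw') => //; lia.
  by apply: (strict_interlace_lt_bot uw) => //; lia.
rewrite divr_gt0// subr_gt0.
  by apply: (strict_interlace_lt_bot uw') => //; lia.
by apply: (strict_interlace_lt_bot uw) => //; lia.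
Qed.

Lemma strict_array_line N y v : strict_array N y ->
  exists2 r, 0 < r & forall t, `|t| < r ->
    strict_array N (fun k i => y k i + t * v k i).
Proof.
move=> sy; have [r r0 hr] := strict_array_near sy.
have [k i _ _|g g0 gv] := @triangle_lower_bound R N (fun k i => (1 + `|v k i|)^-1).
  by rewrite invr_gt0 ltr_pwDl.
exists (r * g); first by rewrite mulr_gt0.
move=> t tr; apply: hr => k i ik kN; rewrite addrAC subrr add0r normrM.
apply: (@le_lt_trans _ _ (`|t| * g^-1)); last by rewrite ltr_pdivrMr.
rewrite ler_wpM2l//; have := gv k i ik kN.
have v1 : 0 < 1 + `|v k i| by rewrite ltr_pwDl.
rewrite -[leLHS]invrK lef_pV2 ?posrE ?invr_gt0// => h; apply: le_trans h.
by rewrite lerDr.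
Qed.

(** Along the line y + t v the difference D(t) between the bound of
[log_density_le] and the increment of the logarithmic density is nonnegative
near 0 and vanishes at 0, so its derivative at 0 vanishes: the bound and the
logarithmic density have the same directional derivatives at y. *)
Lemma coupling_tangent N d y v : (1 <= N)%N -> strict_array N y ->
  critical N d y -> (forall i, (1 <= i <= N)%N -> v N i = 0) ->
  \sum_(1 <= k < N) \sum_(1 <= p < k.+1) \sum_(1 <= q < k.+2)
    array_coupling y k p q * ((v k p - v k.+1 q) / (y k p - y k.+1 q)) +
  \sum_(1 <= k < N) \sum_(1 <= i < k.+1) v k i * d k = 0.
Proof.
move=> N1 sy cy vN; have [r r0 hr] := strict_array_line v sy.
pose X k p q := (v k p - v k.+1 q) / (y k p - y k.+1 q).
pose Z k i j := (v k i - v k j) / (y k i - y k j).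
pose P := array_coupling y.
pose D t :=
  \sum_(1 <= k < N) \sum_(1 <= p < k.+1) \sum_(1 <= q < k.+2)
     (P k p q - 1) * ln (1 + t * X k p q) +
  \sum_(1 <= k < N) \sum_(1 <= i < k.+1) \sum_(1 <= j < k.+1 | j != i)
     1 * ln (1 + t * Z k i j).
have XE t k p q : (1 <= k < N)%N -> (1 <= p < k.+1)%N -> (1 <= q < k.+2)%N ->
    1 + t * X k p q =
    ((y k p + t * v k p) - (y k.+1 q + t * v k.+1 q)) / (y k p - y k.+1 q).
  move=> kN pk qk; rewrite /X.
  by field; rewrite subr_eq0 (cross_neq (sy k kN)).
have ZE t k i j : (1 <= k < N)%N -> (1 <= i < k.+1)%N -> (1 <= j < k.+1)%N ->
    j != i -> 1 + t * Z k i j =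
    ((y k i + t * v k i) - (y k j + t * v k j)) / (y k i - y k j).
  move=> kN ik jk ji; rewrite /Z.
  by field; rewrite subr_eq0 (bot_neq (sy k kN))// eq_sym.
have X0 t k p q : `|t| < r -> (1 <= k < N)%N -> (1 <= p < k.+1)%N ->
    (1 <= q < k.+2)%N -> 0 < 1 + t * X k p q.
  move=> tr kN pk qk; rewrite XE//.
  exact: cross_ratio_gt0 (sy k kN) (hr t tr k kN) pk qk.
have Z0 t k i j : `|t| < r -> (1 <= k < N)%N -> (1 <= i < k.+1)%N ->
    (1 <= j < k.+1)%N -> j != i -> 0 < 1 + t * Z k i j.
  move=> tr kN ik jk ji; rewrite ZE//.
  exact: bot_ratio_gt0 (sy k kN) (hr t tr k kN) ik jk ji.
have dD t : `|t| < r -> is_derive t (1 : R) D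
    (\sum_(1 <= k < N) \sum_(1 <= p < k.+1) \sum_(1 <= q < k.+2)
       (P k p q - 1) * (X k p q / (1 + t * X k p q)) +
     \sum_(1 <= k < N) \sum_(1 <= i < k.+1) \sum_(1 <= j < k.+1 | j != i)
       1 * (Z k i j / (1 + t * Z k i j))).
  move=> tr; apply: is_deriveD.
    apply: is_derive_sum_nat => k kN _; apply: is_derive_sum_nat => p pk _.
    apply: is_derive_sum_nat => q qk _; apply: is_derive_ln_affine; exact: X0.
  apply: is_derive_sum_nat => k kN _; apply: is_derive_sum_nat => i ik _.
  apply: is_derive_sum_nat => j jk ji; apply: is_derive_ln_affine; exact: Z0.
have D0 : D 0 = 0.
  rewrite /D big1 ?big1 ?addr0// => k _; rewrite big1// => i _;
  by rewrite big1// => j _; rewrite mul0r addr0 ln1 mulr0.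
have lnX t k p q : `|t| < r -> (1 <= k < N)%N -> (1 <= p < k.+1)%N ->
    (1 <= q < k.+2)%N -> ln (1 + t * X k p q) =
    ln `|(y k p + t * v k p) - (y k.+1 q + t * v k.+1 q)|
    - ln `|y k p - y k.+1 q|.
  move=> tr kN pk qk; have st := hr t tr.
  rewrite -ln_div ?posrE ?normr_gt0 ?subr_eq0 ?(cross_neq (sy k kN))//.
    by rewrite -normf_div -XE// gtr0_norm// X0.
  exact: (cross_neq (st k kN)).
have lnZ t k i j : `|t| < r -> (1 <= k < N)%N -> (1 <= i < k.+1)%N ->
    (1 <= j < k.+1)%N -> j != i -> ln (1 + t * Z k i j) =
    ln `|(y k i + t * v k i) - (y k j + t * v k j)| - ln `|y k i - y k j|.
  move=> tr kN ik jk ji; have st := hr t tr; have ij : i != j by rewrite eq_sym.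
  rewrite -ln_div ?posrE ?normr_gt0 ?subr_eq0 ?(bot_neq (sy k kN))//.
    by rewrite -normf_div -ZE// gtr0_norm// Z0.
  exact: (bot_neq (st k kN)).
have Dge t : `|t| < r -> 0 <= D t.
  move=> tr; have st := hr t tr.
  pose y' k i := y k i + t * v k i.
  have y'N i : (1 <= i <= N)%N -> y' N i = y N i.
    by move=> iN; rewrite /y' vN// mulr0 addr0.
  have := @log_density_le R N d y y' N1 sy st y'N.
  have -> : log_density N d y' - log_density N d y =
    \sum_(1 <= k < N) (\sum_(1 <= p < k.+1) \sum_(1 <= q < k.+2)
      ln (1 + t * X k p q) -
      \sum_(1 <= i < k.+1) \sum_(1 <= j < k.+1 | j != i) ln (1 + t * Z k i j)) +
    \sum_(1 <= k < N) \sum_(1 <= i < k.+1) (y' k i - y k i) * d k.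
    rewrite /log_density opprD addrACA -!sumrB; congr (_ + _).
      apply: eq_big_nat => k kN.
      have -> : \sum_(1 <= p < k.+1) \sum_(1 <= q < k.+2) ln (1 + t * X k p q) =
          cross_log k (y' k) (y' k.+1) - cross_log k (y k) (y k.+1).
        rewrite -sumrB; apply: eq_big_nat => p pk.
        by rewrite -sumrB; apply: eq_big_nat => q qk; rewrite lnX.
      have -> : \sum_(1 <= i < k.+1) \sum_(1 <= j < k.+1 | j != i)
          ln (1 + t * Z k i j) = self_log k (y' k) - self_log k (y k).
        rewrite -sumrB; apply: eq_big_nat => i ik; rewrite -sumrB.
        rewrite big_nat_cond [RHS]big_nat_cond.
        by apply: eq_bigr => j /andP[jk ji]; rewrite lnZ.
      by ring.
    by apply: eq_bigr => k _; rewrite -sumrB; apply: eq_bigr => i _; rewrite mulrBl.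
  rewrite lerD2r -subr_ge0 -sumrB; congr (0 <= _).
  rewrite /D -big_split/=; apply: eq_big_nat => k kN; rewrite opprB addrCA addrC.
  congr (_ + _).
    rewrite -sumrB; apply: eq_big_nat => p pk; rewrite -sumrB.
    by apply: eq_big_nat => q qk; rewrite -lnX// mulrBl mul1r.
  by apply: eq_bigr => i _; apply: eq_bigr => j _; rewrite mul1r.
have rr : (0 : R) \in `](- r), r[ by rewrite in_itv/= oppr_lt0 r0.
have nr t : t \in `](- r), r[ -> `|t| < r by rewrite in_itv/= ltr_norml.
have Dmin : is_derive (0 : R) (1 : R) D 0.
  apply: (@derive1_at_min R D (- r) r 0) => //; first by lra.
  - by move=> t /nr tr; have [] := dD t tr.
  - by move=> t /nr tr; rewrite D0 Dge.
have [_ Dmin0] := Dmin; have [_] := dD 0 ltac:(by rewrite normr0).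
rewrite Dmin0 => e; rewrite -[RHS](critical_variation N1 cy vN).
congr (_ + _); apply/eqP; rewrite -subr_eq0; apply/eqP.
rewrite [RHS]e -sumrB -big_split/=; apply: eq_bigr => k _.
rewrite opprB addrCA addrC; congr (_ + _).
  rewrite -sumrB; apply: eq_bigr => p _; rewrite -sumrB; apply: eq_bigr => q _.
  by rewrite mul0r addr0 divr1 [RHS]mulrBl mul1r.
apply: eq_bigr => i _; apply: eq_bigr => j _.
by rewrite mul0r addr0 divr1 mul1r.
Qed.

End tangent.

(** * Separation of the maximum *)

Section concavity_gap.
Context {R : realType}.
Implicit Types (N k : nat) (y v : nat -> nat -> R) (d : nat -> R).

(** With s the square root of t, ln t = 2 ln s <= 2 (s - 1), hence
ln t - (t - 1) <= - (s - 1)^2. *)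
Lemma ln_gap (t e : R) : 0 < t -> 0 <= e <= 1 -> e <= `|t - 1| ->
  ln t - (t - 1) <= - (e / 3) ^+ 2.
Proof.
move=> t0 /andP[e0 e1] et; set s := Num.sqrt t.
have s0 : 0 < s by rewrite sqrtr_gt0.
have ts : t = s ^+ 2 by rewrite sqr_sqrtr// ltW.
have lns : ln s <= s - 1.
  rewrite -[in leLHS](subrKC 1 s) le_ln1Dx//; lra.
have -> : ln t = 2 * ln s by rewrite ts lnXn// mulr_natl.
suff : e / 3 <= `|s - 1|.
  rewrite -(ler_pXn2r (n := 2))// ?nnegrE ?divr_ge0// real_normK ?num_real//.
  by rewrite ts; lra.
rewrite leNgt; apply/negP => h; move: et; apply/negP; rewrite -ltNge.
have -> : t - 1 = (s - 1) * (s + 1) by rewrite ts; ring.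
move: (h); rewrite ltr_norml => /andP[h1 h2].
rewrite normrM (gtr0_norm (_ : 0 < s + 1)); last lra.
apply: (@le_lt_trans _ _ (`|s - 1| * 3)); last lra.
by rewrite ler_wpM2l//; lra.
Qed.

Lemma sum_nat_le_term m n (F : nat -> R) j :
  (forall i, (m <= i < n)%N -> F i <= 0) -> (m <= j < n)%N ->
  \sum_(m <= i < n) F i <= F j.
Proof.
move=> F0 jmn; rewrite (bigD1_seq j)/= ?iota_uniq ?mem_index_iota//.
rewrite gerDl big_nat_cond; apply: sumr_le0 => i /andP[imn _]; exact: F0.
Qed.

Lemma dist_le_steps (v : nat -> R) k n e : (k <= n)%N ->
  (forall m, (k <= m < n)%N -> `|v m - v m.+1| <= e) ->
  `|v k - v n| <= (n - k)%:R * e.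
Proof.
elim: n => [|n IH]; first by rewrite leqn0 => /eqP->; rewrite subrr normr0 mul0r.
rewrite leq_eqVlt => /predU1P[<- _|kn ve]; first by rewrite subrr subnn normr0 mul0r.
have h1 := IH kn (fun m hm => ve m ltac:(lia)).
have h2 := ve n ltac:(lia).
rewrite subSn// -natr1 mulrDl mul1r -(subrKA (v n)).
by apply: le_trans (ler_normD _ _) _; rewrite lerD.
Qed.

(** If an entry moves by more than eps while the top row is fixed, then along the
chain y^k_i, y^(k+1)_i, .., y^N_i some consecutive difference changes by more
than eps / N; the corresponding diagonal term of the bound is then at most a
negative constant independent of y', all the other terms being nonpositive. *)
Lemma log_density_gap N d y eps : (1 <= N)%N -> strict_array N y ->
  critical N d y -> 0 < eps -> exists2 del, 0 < del & forall y',
    strict_array N y' -> (forall i, (1 <= i <= N)%N -> y' N i = y N i) ->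
    forall k i, (1 <= i <= k)%N -> (k <= N)%N -> eps < `|y' k i - y k i| ->
    log_density N d y' <= log_density N d y - del.
Proof.
move=> N1 sy cy eps0.
(* The relative change of y^k_i - y^(k+1)_i caused by an absolute change of
   eps / N, capped at 1 as ln_gap requires. *)
pose step k i := Num.min 1 (eps / N%:R / `|y k i - y k.+1 i|).
pose f k i := if (k < N)%N then array_coupling y k i i * (step k i / 3) ^+ 2 else 1.
have N0 : 0 < N%:R :> R by rewrite ltr0n.
have y0 k i : (1 <= i <= k)%N -> (k < N)%N -> 0 < `|y k i - y k.+1 i|.
  by move=> ik kN; rewrite normr_gt0 subr_eq0 (cross_neq (sy k _))//; lia.
have step0 k i : (1 <= i <= k)%N -> (k < N)%N -> 0 < step k i.
  by move=> ik kN; rewrite lt_min ltr01 !divr_gt0// y0.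
have P0 k p q : (1 <= k < N)%N -> (1 <= p <= k)%N -> (1 <= q <= k.+1)%N ->
    0 < array_coupling y k p q.
  by move=> kN pk qk; apply: coupling_gt0 => //; exact: sy.
have [k i ik kN|del del0 hdel] := @triangle_lower_bound R N f.
  rewrite /f; case: ifPn => // kN'; rewrite mulr_gt0 ?exprn_gt0//.
    by apply: P0; lia.
  by rewrite divr_gt0// step0.
exists del => // y' sy' y'N k i ik kN far.
pose v k i := y' k i - y k i.
have vN j : (1 <= j <= N)%N -> v N j = 0 by move=> jN; rewrite /v y'N// subrr.
(* v^N_i = 0, so one of the steps from v^k_i to v^N_i exceeds eps / N. *)
have [m [km mN far']] : exists m, [/\ (k <= m)%N, (m < N)%N &
    eps / N%:R < `|v m i - v m.+1 i|].
  apply: contrapT => /forallNP H; move: far; apply/negP; rewrite -leNgt.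
  have := @dist_le_steps (fun m => v m i) k N (eps / N%:R) kN.
  rewrite /= vN ?subr0; last lia.
  move=> h; apply: (le_trans (h _)) => [m /andP[km mN]|].
    by rewrite leNgt; apply/negP => ?; apply: (H m).
  by rewrite mulrCA ler_piMr ?(ltW eps0)// ler_pdivrMr// mul1r ler_nat leq_subr.
have mi : (1 <= i <= m)%N by lia.
have := log_density_le d N1 sy sy' y'N.
have := coupling_tangent N1 sy cy vN.
set A := \sum_(_ <= _ < _) _; set lin := \sum_(_ <= _ < _) _.
set B := \sum_(_ <= _ < _) _ => tan le.
suff : B - A <= - del by lra.
apply: (@le_trans _ _ (- f m i)); last by rewrite lerN2 hdel// ltnW.
pose X k p q := (v k p - v k.+1 q) / (y k p - y k.+1 q).
have XE k' p q : (1 <= k' < N)%N -> (1 <= p <= k')%N -> (1 <= q <= k'.+1)%N ->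
    1 + X k' p q = (y' k' p - y' k'.+1 q) / (y k' p - y k'.+1 q).
  move=> kN' pk qk; rewrite /X /v.
  by field; rewrite subr_eq0 (cross_neq (sy k' kN')).
have X0 k' p q : (1 <= k' < N)%N -> (1 <= p <= k')%N -> (1 <= q <= k'.+1)%N ->
    0 < 1 + X k' p q.
  by move=> kN' pk qk; rewrite XE//; exact: cross_ratio_gt0 (sy k' kN') (sy' k' kN') pk qk.
pose T k p q := array_coupling y k p q * (ln (1 + X k p q) - X k p q).
have T0 k' p q : (1 <= k' < N)%N -> (1 <= p <= k')%N -> (1 <= q <= k'.+1)%N ->
    T k' p q <= 0.
  move=> kN' pk qk; rewrite /T pmulr_rle0 ?P0// subr_le0 le_ln1Dx//.
  by have := X0 k' p q kN' pk qk; lra.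
have -> : B - A = \sum_(1 <= k' < N) \sum_(1 <= p < k'.+1)
    \sum_(1 <= q < k'.+2) T k' p q.
  rewrite /A /B -sumrB; apply: eq_big_nat => k' kN'.
  rewrite -sumrB; apply: eq_big_nat => p pk; rewrite -sumrB.
  apply: eq_big_nat => q qk; rewrite -mulrBr /T; congr (_ * (_ - _)).
  rewrite -ln_div ?posrE ?normr_gt0 ?subr_eq0 ?(cross_neq (sy k' kN'))//.
    by rewrite -normf_div -XE// gtr0_norm// X0.
  by rewrite (cross_neq (sy' k' kN')).
have mN' : (1 <= m < N)%N by lia.
apply: le_trans (sum_nat_le_term (j := m) _ mN') _.
  move=> k' kN'; rewrite big_nat; apply: sumr_le0 => p pk.
  by rewrite big_nat; apply: sumr_le0 => q qk; exact: T0.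
apply: le_trans (sum_nat_le_term (j := i) _ _) _; [|by []|].
  by move=> p pk; rewrite big_nat; apply: sumr_le0 => q qk; exact: T0.
apply: le_trans (sum_nat_le_term (j := i) _ _) _; [|by lia|].
  by move=> q qk; exact: T0.
rewrite /f mN /T -[leRHS]mulrN ler_pM2l ?P0//; last lia.
rewrite [Z in _ - Z](_ : _ = 1 + X m i i - 1); last by rewrite addrAC subrr add0r.
apply: ln_gap; first by apply: X0 => //; lia.
  by rewrite ge_min lexx andbT ltW// step0.
rewrite addrAC subrr add0r /X normf_div /step ge_min.
rewrite ler_pdivrMr ?y0// divfK ?gt_eqF ?y0//.
by rewrite (ltW far') orbT.
Qed.

End concavity_gap.

(** * Continuity near an array *)

Section box.
Context {R : realType}.
Implicit Types (N k : nat) (y : nat -> nat -> R) (d : nat -> R).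

(** Uniform closeness on the triangle of relevant indices, packaged as a filter
so that limits of sums and logarithms apply. *)
Definition box_nbhs N y : set_system (nat -> nat -> R) :=
  filter_from [set r : R | 0 < r] (fun r => [set y' | forall k i,
    (1 <= i <= k)%N -> (k <= N)%N -> `|y' k i - y k i| < r]).

#[local] Instance box_nbhs_filter N y : Filter (box_nbhs N y).
Proof.
apply: filter_from_filter; first by exists 1 => /=.
move=> r s /= r0 s0; exists (Num.min r s); first by rewrite /= lt_min r0.
by move=> y' /= hy; split=> k i ik kN; have := hy k i ik kN;
  rewrite lt_min => /andP[].
Qed.

Lemma cvg_sum_nat m n (P : pred nat) (f : nat -> (nat -> nat -> R) -> R)
    (l : nat -> R) (F : set_system (nat -> nat -> R)) (FF : Filter F) :
  (forall i, (m <= i < n)%N -> P i -> f i y @[y --> F] --> l i) ->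
  \sum_(m <= i < n | P i) f i y @[y --> F] --> \sum_(m <= i < n | P i) l i.
Proof.
move=> fl.
have {}fl i : i \in index_iota m n -> P i -> f i y @[y --> F] --> l i.
  by rewrite mem_index_iota; exact: fl.
elim: (index_iota m n) fl => [_|i r IH fl].
  rewrite big_nil; under eq_fun do rewrite big_nil.
  exact: cvg_cst.
have {}IH := IH (fun j jr => fl j (mem_behead (s := i :: r) jr)).
rewrite big_cons; case: ifPn => Pi.
  under eq_fun do rewrite big_cons Pi.
  by apply: cvgD => //; apply: fl => //; rewrite mem_head.
by under eq_fun do rewrite big_cons (negbTE Pi).
Qed.

Lemma cvg_box_entry N y k i : (1 <= i <= k)%N -> (k <= N)%N ->
  y' k i @[y' --> box_nbhs N y] --> y k i.
Proof.
move=> ik kN; apply/cvgrPdist_lt => e e0; exists e => //= y' hy.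
by rewrite distrC; apply: hy.
Qed.

Lemma cvg_box_ln N y k i k' i' : (1 <= i <= k)%N -> (k <= N)%N ->
  (1 <= i' <= k')%N -> (k' <= N)%N -> y k i != y k' i' ->
  ln `|y' k i - y' k' i'| @[y' --> box_nbhs N y] --> ln `|y k i - y k' i'|.
Proof.
move=> ik kN ik' kN' ne.
have cn : `|y' k i - y' k' i'| @[y' --> box_nbhs N y] --> `|y k i - y k' i'|.
  by apply: cvg_norm; apply: cvgB; exact: cvg_box_entry.
apply: (continuous_cvg _ _ cn).
by apply: continuous_ln; rewrite normr_gt0 subr_eq0.
Qed.

Lemma cvg_box_cross N y k : strict_array N y -> (1 <= k < N)%N ->
  cross_log k (y' k) (y' k.+1) @[y' --> box_nbhs N y] -->
  cross_log k (y k) (y k.+1).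
Proof.
move=> sy kN; apply: cvg_sum_nat => p pk _; apply: cvg_sum_nat => q qk _.
apply: cvg_box_ln; try lia.
exact: (cross_neq (sy k kN)).
Qed.

Lemma cvg_box_self N y k : strict_array N y -> (1 <= k < N)%N ->
  self_log k (y' k) @[y' --> box_nbhs N y] --> self_log k (y k).
Proof.
move=> sy kN; apply: cvg_sum_nat => i ik _; apply: cvg_sum_nat => j jk ji.
apply: cvg_box_ln; try lia.
by rewrite (bot_neq (sy k kN))// eq_sym.
Qed.

(** The part of the logarithm of the density which is not multiplied by beta. It
can be unbounded on interlacing arrays, and its exponential need not even be
integrable there. *)
Definition log_factor N y : R :=
  \sum_(1 <= k < N) (self_log k (y k) - cross_log k (y k) (y k.+1)).

Lemma box_lower N d y e : strict_array N y -> 0 < e ->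
  exists2 r, 0 < r & forall y',
    (forall k i, (1 <= i <= k)%N -> (k <= N)%N -> `|y' k i - y k i| < r) ->
    [/\ strict_array N y', log_density N d y - e <= log_density N d y' &
        log_factor N y - e <= log_factor N y'].
Proof.
move=> sy e0; have [s s0 hs] := strict_array_near sy.
have cL : log_density N d y' @[y' --> box_nbhs N y] --> log_density N d y.
  apply: cvgD; apply: cvg_sum_nat => k kN _.
    by apply: cvgB; [exact: cvg_box_cross|exact: cvg_box_self].
  apply: cvg_sum_nat => i ik _; apply: cvgM; last exact: cvg_cst.
  by apply: cvg_box_entry; lia.
have cG : log_factor N y' @[y' --> box_nbhs N y] --> log_factor N y.
  apply: cvg_sum_nat => k kN _.
  by apply: cvgB; [exact: cvg_box_self|exact: cvg_box_cross].
have /cvgrPdist_lt/(_ _ e0)[r1 /= r10 h1] := cL.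
have /cvgrPdist_lt/(_ _ e0)[r2 /= r20 h2] := cG.
exists (Num.min s (Num.min r1 r2)); first by rewrite !lt_min s0 r10 r20.
move=> y' hy; split.
- by apply: hs => k i ik kN; have := hy k i ik kN; rewrite lt_min => /andP[].
- have /ltW := h1 y' (fun k i ik kN => ltac:(
    by have := hy k i ik kN; rewrite !lt_min => /and3P[])).
  by rewrite ler_norml => /andP[_]; rewrite lerBlDr -lerBlDl.
- have /ltW := h2 y' (fun k i ik kN => ltac:(
    by have := hy k i ik kN; rewrite !lt_min => /and3P[])).
  by rewrite ler_norml => /andP[_]; rewrite lerBlDr -lerBlDl.
Qed.

End box.

(** * The density as an exponential *)

Section weight.
Context {R : realType}.
Variables (N : nat) (z a : N.-tuple R).
Let m := 'C(N, 2).
Notation space := (m.-tuple (measurableTypeR R)).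

Definition drift (k : nat) : R := entry a k - entry a k.+1.

Definition scaled (beta : R) : N.-tuple R := map_tuple (fun x => beta / 2 * x) a.

Lemma entry_scaled beta k : entry (scaled beta) k = beta / 2 * entry a k.
Proof.
rewrite /entry /=; case: (ltnP k.-1 (size a)) => ka; first exact: nth_map.
by rewrite !nth_default ?size_map// mulr0.
Qed.

Lemma powR_expR (x e : R) : 0 < x -> x `^ e = expR (e * ln x).
Proof. by move=> x0; rewrite /powR gt_eqF. Qed.

Lemma self_log_pairs k (u : nat -> R) : self_log k u =
  2 * \sum_(1 <= i < k.+1) \sum_(i.+1 <= j < k.+1) ln `|u i - u j|.
Proof.
have up i : \sum_(i.+1 <= j < k.+1) ln `|u i - u j| =
    \sum_(1 <= j < k.+1 | (i < j)%N) ln `|u i - u j|.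
  by rewrite (@big_nat_widenl _ _ _ i.+1 1).
have dn : \sum_(1 <= i < k.+1) \sum_(1 <= j < k.+1 | (j < i)%N) ln `|u i - u j| =
    \sum_(1 <= i < k.+1) \sum_(1 <= j < k.+1 | (i < j)%N) ln `|u i - u j|.
  rewrite (exchange_big_dep predT)//=; apply: eq_bigr => j _.
  by apply: eq_bigr => i _; rewrite distrC.
under [in RHS]eq_bigr do rewrite up.
rewrite mulr2n mulrDl mul1r -{1}dn -big_split/=; apply: eq_bigr => i _.
rewrite (bigID (fun j => (j < i)%N))/=; congr (_ + _); apply: eq_bigl => j.
  by case: ltngtP.
by case: ltngtP.
Qed.

Lemma corners_weight_strict beta (Y : space) :
  strict_array N (corners_array z Y) ->
  corners_weight beta (scaled beta) z Y =
  expR (beta / 2 * log_density N drift (corners_array z Y) +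
        log_factor N (corners_array z Y)).
Proof.
set y := corners_array z Y => sy; rewrite /corners_weight -/y.
rewrite indicE mem_set ?mul1r; last first.
  by move=> k kN i ik; have /andP[h1 h2] := sy k kN i ik; rewrite !ltW.
have -> : \prod_(1 <= k < N)
    ((\prod_(1 <= i < k.+1) \prod_(i.+1 <= j < k.+1)
        (y k i - y k j) `^ (2 - beta)) *
     (\prod_(1 <= p < k.+1) \prod_(1 <= q < k.+2)
        `|y k p - y k.+1 q| `^ (beta / 2 - 1))) =
   expR (\sum_(1 <= k < N) ((1 - beta / 2) * self_log k (y k) +
     (beta / 2 - 1) * cross_log k (y k) (y k.+1))).
  rewrite expR_sum; apply: eq_big_nat => k kN; rewrite expRD; congr (_ * _).
    rewrite self_log_pairs mulrA big_distrr/= expR_sum; apply: eq_big_nat => i ik.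
    rewrite big_distrr/= expR_sum; apply: eq_big_nat => j jk.
    have d0 : 0 < y k i - y k j.
      by rewrite subr_gt0; apply: (strict_interlace_lt_bot (sy k kN)); lia.
    by rewrite powR_expR// gtr0_norm//; congr (expR (_ * _)); field.
  rewrite /cross_log big_distrr/= expR_sum; apply: eq_big_nat => p pk.
  rewrite big_distrr/= expR_sum; apply: eq_big_nat => q qk.
  by rewrite powR_expR// normr_gt0 subr_eq0 (cross_neq (sy k kN)).
rewrite -expRD; congr expR.
have -> : \sum_(1 <= k < N) \sum_(1 <= i < k.+1)
      y k i * (entry (scaled beta) k - entry (scaled beta) k.+1) =
    beta / 2 * \sum_(1 <= k < N) \sum_(1 <= i < k.+1) y k i * drift k.
  rewrite big_distrr/=; apply: eq_bigr => k _; rewrite big_distrr/=.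
  by apply: eq_bigr => i _; rewrite !entry_scaled /drift; ring.
rewrite /log_density mulrDr addrAC; congr (_ + _).
rewrite /log_factor big_distrr/= -big_split/=; apply: eq_bigr => k _; ring.
Qed.

(** For beta > 2 the exponent of |y^k_p - y^(k+1)_q| is positive, so a
coincidence between consecutive rows annihilates the product. *)
Lemma corners_weight_neq0_strict beta (Y : space) : 2 < beta ->
  corners_weight beta (scaled beta) z Y != 0 ->
  strict_array N (corners_array z Y).
Proof.
move=> b2; rewrite /corners_weight !mulf_eq0 !negb_or => /andP[/andP[I0 P0] _].
have inter : interlacing_arrays z Y.
  by apply: contrapT => nI; move: I0; rewrite indicE memNset// eqxx.
move=> k kN i ik.
have ne q : (1 <= q <= k.+1)%N -> corners_array z Y k i != corners_array z Y k.+1 q.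
  move=> qk; move: P0; rewrite prodf_seq_neq0 => /allP/(_ k).
  rewrite mem_index_iota kN => /(_ isT)/=; rewrite mulf_eq0 negb_or => /andP[_].
  rewrite prodf_seq_neq0 => /allP/(_ i); rewrite mem_index_iota => /(_ ltac:(lia)).
  rewrite /= prodf_seq_neq0 => /allP/(_ q); rewrite mem_index_iota => /(_ ltac:(lia)).
  rewrite /=; apply: contra => /eqP ->; rewrite subrr normr0 powR0//.
  by rewrite subr_eq0 gt_eqF// ltr_pdivlMr// mul1r.
have /andP[h1 h2] := inter k kN i ik.
rewrite !lt_neqAle h1 h2 !andbT ne ?andbT; last lia.
by rewrite eq_sym ne//; lia.
Qed.

Lemma corners_weight_ge0 beta (Y : space) :
  0 <= corners_weight beta (scaled beta) z Y.
Proof.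
rewrite /corners_weight !mulr_ge0 ?expR_ge0//.
apply: prodr_ge0 => k _; apply: mulr_ge0; apply: prodr_ge0 => i _;
  apply: prodr_ge0 => j _; exact: powR_ge0.
Qed.

Lemma measurable_corners_array k i :
  measurable_fun [set: space] (fun Y : space => corners_array z Y k i : measurableTypeR R).
Proof.
rewrite /corners_array; case: (k == N); first exact: measurable_cst.
rewrite /entry; have [jm|mj] := ltnP ('C(k, 2) + i).-1 m.
  rewrite (_ : (fun _ => _) = @tnth m _ ^~ (Ordinal jm)); last first.
    by apply/funext => Y; rewrite (tnth_nth 0).
  exact: measurable_tnth.
rewrite (_ : (fun _ => _) = cst 0); first exact: measurable_cst.
by apply/funext => Y; rewrite nth_default// size_tuple.
Qed.

Lemma measurable_interlacing_arrays : measurable (interlacing_arrays z : set space).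
Proof.
rewrite /interlacing_arrays.
rewrite (_ : mkset _ = \bigcap_(k in `I_N) \bigcap_(i in `I_k.+1)
  [set Y : space | (1 <= i)%N -> (1 <= k)%N ->
    corners_array z Y k.+1 i.+1 <= corners_array z Y k i <=
    corners_array z Y k.+1 i]); last first.
  apply/seteqP; split=> Y /= h.
    by move=> k /= kN i /= ik i1 k1; apply: h; lia.
  by move=> k kN i ik; apply: (h k _ i) => /=; lia.
apply: fin_bigcap_measurable; first exact: finite_II.
move=> k _; apply: fin_bigcap_measurable; first exact: finite_II.
move=> i _.
have [i1|i0] := boolP (1 <= i)%N; last first.
  by rewrite (_ : mkset _ = setT)//; apply/seteqP; split.
have [k1|k0] := boolP (1 <= k)%N; last first.
  by rewrite (_ : mkset _ = setT)//; apply/seteqP; split.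
rewrite (_ : mkset _ =
  (setT `&` [set Y : space | corners_array z Y k.+1 i.+1 <= corners_array z Y k i]) `&`
  (setT `&` [set Y : space | corners_array z Y k i <= corners_array z Y k.+1 i])).
  apply: measurableI; apply: measurable_fun_le => //;
  exact: measurable_corners_array.
apply/seteqP; split=> Y /=.
  by move=> /(_ isT isT)/andP[].
by move=> [[_ h1] [_ h2]] _ _; rewrite h1 h2.
Qed.

Lemma measurable_corners_weight beta :
  measurable_fun [set: space] (corners_weight beta (scaled beta) z).
Proof.
have mB k i k' i' : measurable_fun [set: space]
    (fun Y : space => corners_array z Y k i - corners_array z Y k' i').
  by apply: measurable_funB; exact: measurable_corners_array.
rewrite /corners_weight; apply: measurable_funM; first apply: measurable_funM.
- exact: measurable_indic measurable_interlacing_arrays.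
- apply: measurable_prod => k _; apply: measurable_funM.
    apply: measurable_prod => i _; apply: measurable_prod => j _.
    exact: (measurableT_comp (measurable_powR _)).
  apply: measurable_prod => p _; apply: measurable_prod => q _.
  apply: (measurableT_comp (measurable_powR _)).
  exact: measurableT_comp.
- apply: measurableT_comp => //; apply: measurable_sum => k.
  apply: measurable_sum => i; apply: measurable_funM => //.
  exact: measurable_corners_array.
Qed.

End weight.

(** * Concentration of the law *)

(** Provides the centre of a box around y in the coordinates of the space of
arrays. *)
Lemma array_listing (R : realType) (y : nat -> nat -> R) N :
  exists s : nat -> R,
    forall k i, (1 <= i <= k)%N -> (k < N)%N -> s ('C(k, 2) + i)%N = y k i.
Proof.
elim: N => [|N [s hs]]; first by exists (fun=> 0).
exists (fun n => if (n <= 'C(N, 2))%N then s n else y N (n - 'C(N, 2))%N).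
move=> k i ik; rewrite ltnS leq_eqVlt => /predU1P[->|kN].
  by rewrite addKn ifF//; lia.
rewrite ifT ?hs//.
have : ('C(k.+1, 2) <= 'C(N, 2))%N by exact: leq_bin2l.
by rewrite binS bin1; lia.
Qed.

Section box_measure.
Context {R : realType}.
Variables (N : nat) (z : N.-tuple R) (y : nat -> nat -> R).
Let m := 'C(N, 2).
Notation space := (m.-tuple (measurableTypeR R)).

Lemma box_measure (r : R) : 0 < r ->
  (forall i, (1 <= i <= N)%N -> y N i = entry z i) ->
  exists B : set space, exists2 vol : R, 0 < vol &
    [/\ measurable B, lebesgue_tuple R m B = vol%:E &
      forall Y, B Y -> forall k i, (1 <= i <= k)%N -> (k <= N)%N ->
        `|corners_array z Y k i - y k i| < r].
Proof.
move=> r0 yN; have [s hs] := array_listing y N.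
pose A (i : 'I_m) : set (measurableTypeR R) := `]s i.+1 - r, s i.+1 + r[%classic.
have mA i : measurable (A i) by exact: measurable_itv.
exists [set Y | forall i, A i (tnth Y i)]; exists ((r * 2) ^+ m).
  by rewrite exprn_gt0// mulr_gt0.
split.
- rewrite (_ : mkset _ =
      \bigcap_(i in [set: 'I_m]) ((fun Y : space => tnth Y i) @^-1` A i)).
    apply: fin_bigcap_measurable => // i _.
    by rewrite -[X in measurable X]setTI; exact: measurable_tnth.
  by apply/seteqP; split=> Y /= h i; [move=> _|]; exact: h.
- rewrite /lebesgue_tuple tuple_measure_box//.
  rewrite (eq_bigr (fun=> (r * 2)%:E)).
    by rewrite prodEFin big_const card_ord iter_mulr_1.
  move=> i _; rewrite [LHS](lebesgue_measure_itv `]s i.+1 - r, s i.+1 + r[)/=.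
  rewrite lte_fin ifT.
    by rewrite -EFinB; congr EFin; ring.
  by rewrite ltrBlDr -addrA ltrDl addr_gt0.
- move=> Y BY k i ik kN; rewrite /corners_array; case: eqVneq => [kE|kneN].
    by rewrite -yN -?kE// kE subrr normr0.
  have {}kN : (k < N)%N by rewrite ltn_neqAle kneN.
  have jm : (('C(k, 2) + i).-1 < m)%N.
    have : ('C(k.+1, 2) <= 'C(N, 2))%N by exact: leq_bin2l.
    by rewrite binS bin1 /m; lia.
  have := BY (Ordinal jm); rewrite /A (tnth_nth 0)/= in_itv/= prednK; last lia.
  by rewrite hs// /entry -ltr_distl.
Qed.

End box_measure.

Section law.
Context {R : realType}.
Variables (N : nat) (z a : N.-tuple R) (beta : R).
Let m := 'C(N, 2).
Notation space := (m.-tuple (measurableTypeR R)).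
Notation w := (corners_weight beta (scaled a beta) z).
Context {d : measure_display} {T : measurableType d} (P : probability T R).
Variables (Y : {RV P >-> space}) (c : R).
Hypothesis law : forall A, measurable A -> distribution P Y A =
  (\int[lebesgue_tuple R m]_(x in A) (c * w x)%:E)%E.

(** The total mass 1 excludes a nonpositive normalizing constant. *)
Lemma normalization_gt0 : 0 < c.
Proof.
rewrite ltNge; apply/negP => c0.
have := law measurableT; rewrite probability_setT.
rewrite (eq_integral (fun x => - (- c * w x)%:E)%E); last first.
  by move=> x _; rewrite mulNr EFinN oppeK.
rewrite integral_ge0N; last first.
  by move=> x _; rewrite lee_fin mulr_ge0 ?oppr_ge0// corners_weight_ge0.
move=> e; have : (0 <= - (1%:E : \bar R))%E.
  rewrite e oppeK; apply: integral_ge0 => x _.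
  by rewrite lee_fin mulr_ge0 ?oppr_ge0// corners_weight_ge0.
by rewrite oppe_ge0 lee_fin ler10.
Qed.

Lemma measurable_law_density A :
  measurable_fun A (fun x : space => (c * w x)%:E).
Proof.
apply: measurable_funTS; apply/measurable_EFinP; apply: measurable_funM => //.
exact: measurable_corners_weight.
Qed.

Lemma normalization_le (B : set space) (vol low : R) : measurable B ->
  lebesgue_tuple R m B = vol%:E -> (forall x, B x -> low <= w x) -> 0 <= low ->
  c * low * vol <= 1.
Proof.
move=> mB volB lowB low0; rewrite -lee_fin EFinM -volB -integral_cst//.
apply: (@le_trans _ _ (distribution P Y B)); last exact: probability_le1.
rewrite law//; apply: ge0_le_integral => //.
- by move=> x _; rewrite lee_fin mulr_ge0// ltW// normalization_gt0.
- exact: measurable_law_density.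
- by move=> x Bx; rewrite lee_fin ler_pM2l ?normalization_gt0// lowB.
Qed.

End law.

Section concentration.
Context {R : realType}.
Variables (N : nat) (z a : N.-tuple R) (y : nat -> nat -> R).
Let m := 'C(N, 2).
Notation space := (m.-tuple (measurableTypeR R)).
Notation w beta := (corners_weight beta (scaled a beta) z).
Notation L := (log_density N (drift a)).

Lemma measurable_deviation (eps : R) k i (l : R) :
  measurable [set Y : space | eps < `|corners_array z Y k i - l|].
Proof.
rewrite (_ : mkset _ =
  (fun Y : space => `|corners_array z Y k i - l|) @^-1` `]eps, +oo[%classic).
  rewrite -[X in measurable X]setTI.
  apply: (_ : measurable_fun setT _) => //; apply: measurableT_comp => //.
  by apply: measurable_funB => //; exact: measurable_corners_array.
by apply/seteqP; split => Y /=; rewrite in_itv/= andbT.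
Qed.

(** Comparison with beta = 4 keeps the factor exp G inside a density whose
integral is known to be finite. *)
Lemma corners_weight_le beta (top : R) (Y : space) : 4 <= beta ->
  (strict_array N (corners_array z Y) -> L (corners_array z Y) <= top) ->
  w beta Y <= expR ((beta / 2 - 2) * top) * w 4 Y.
Proof.
move=> b4 hL; have [->|w0] := eqVneq (w beta Y) 0.
  by rewrite mulr_ge0 ?expR_ge0// corners_weight_ge0.
have sY := corners_weight_neq0_strict (lt_le_trans (_ : 2 < 4) b4) w0.
have {}sY := sY ltac:(by rewrite ltr_nat).
rewrite !corners_weight_strict// -expRD ler_expR.
have := hL sY; set l := L _; set g := log_factor _ _ => lt.
have -> : beta / 2 * l + g = (beta / 2 - 2) * l + (4 / 2 * l + g) by field.
rewrite lerD2r ler_wpM2l//; lra.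
Qed.

(** The two bounds on the weights give exponents (beta/2) (L(y) - delta) and
(beta/2) (L(y) - delta/2), whence the rate delta/4. *)
Lemma deviation_le k i (eps : R) : (1 <= N)%N -> (1 <= i <= k)%N -> (k <= N)%N ->
  0 < eps -> strict_array N y -> critical N (drift a) y ->
  (forall j, (1 <= j <= N)%N -> y N j = entry z j) ->
  (exists (d : measure_display) (T : measurableType d) (P : probability T R)
     (Y : {RV P >-> space}), perturbed_corners 4 (scaled a 4) z Y) ->
  exists M kappa : R, 0 < kappa /\ forall (beta : R) (d : measure_display)
    (T : measurableType d) (P : probability T R) (Y : {RV P >-> space}),
    4 <= beta -> perturbed_corners beta (scaled a beta) z Y ->
    (P [set x | (eps < `|corners_array z (Y x) k i - y k i|)%R] <=
     (M * expR (- (kappa * beta)))%:E)%E.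
Proof.
move=> N1 ik kN eps0 sy cy yN [d4 [T4 [P4 [Y4 [c4 law4]]]]].
have [del del0 hdel] := log_density_gap N1 sy cy eps0.
have e0 : 0 < del / 2 by rewrite divr_gt0.
have [r r0 hr] := box_lower (drift a) sy e0.
have [B [vol vol0 [mB volB Br]]] := box_measure r0 yN.
have c40 := normalization_gt0 law4.
set Ly := L y in hr hdel; set Gy := log_factor N y in hr.
exists (expR (- Gy + del / 2 - 2 * (Ly - del)) / (vol * c4)), (del / 4); split.
  by rewrite divr_gt0.
move=> beta d T P Y b4 [c law]; have c0 := normalization_gt0 law.
set A : set space := [set x | eps < `|corners_array z x k i - y k i|].
have mA : measurable A by exact: measurable_deviation.
have low : c * expR (beta / 2 * (Ly - del / 2) + (Gy - del / 2)) * vol <= 1.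
  apply: (normalization_le law mB volB) => // x Bx.
  have [sx hL hG] := hr _ (Br x Bx).
  rewrite corners_weight_strict// ler_expR lerD// ler_wpM2l//; lra.
pose K := c * expR ((beta / 2 - 2) * (Ly - del)) / c4.
have K0 : 0 <= K by rewrite divr_ge0 ?mulr_ge0 ?expR_ge0// ltW.
have PK : (distribution P Y A <= K%:E)%E.
  rewrite law//.
  apply: (@le_trans _ _
    (\int[lebesgue_tuple R m]_(x in A) (K%:E * (c4 * w 4 x)%:E))%E).
    apply: ge0_le_integral => //.
    - by move=> x _; rewrite lee_fin mulr_ge0 ?(ltW c0)// corners_weight_ge0.
    - exact: measurable_law_density.
    - by apply: measurable_funeM; exact: measurable_law_density.
    move=> x Ax; rewrite lee_fin.
    have -> : K * (c4 * w 4 x) = c * (expR ((beta / 2 - 2) * (Ly - del)) * w 4 x).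
      by rewrite /K; field; rewrite gt_eqF.
    rewrite ler_pM2l//; apply: corners_weight_le => // sx.
    apply: (hdel _ sx _ k i) => //.
    by move=> j jN; rewrite yN// /corners_array eqxx.
  rewrite ge0_integralZl//; last 2 first.
  - exact: measurable_law_density.
  - by move=> x _; rewrite lee_fin mulr_ge0 ?(ltW c40)// corners_weight_ge0.
  rewrite -law4// -[leRHS]mule1 lee_wpmul2l// ?lee_fin//.
  exact: probability_le1.
apply: (le_trans PK); rewrite lee_fin /K.
set x := beta / 2 * _ + _ in low.
have cle : c <= expR (- x) / vol.
  by rewrite ler_pdivlMr// expRN -[leRHS]mul1r ler_pdivlMr ?expR_gt0// mulrAC.
apply: (@le_trans _ _ (expR (- x) / vol * expR ((beta / 2 - 2) * (Ly - del)) / c4)).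
  by rewrite ler_pM2r ?invr_gt0// ler_pM2r ?expR_gt0.
have -> : expR (- x) / vol * expR ((beta / 2 - 2) * (Ly - del)) / c4 =
    expR (- x + (beta / 2 - 2) * (Ly - del)) / (vol * c4).
  by rewrite expRD; field; rewrite !gt_eqF.
rewrite mulrAC -expRD ler_pM2r ?invr_gt0 ?mulr_gt0// ler_expR /x.
by rewrite le_eqVlt; apply/orP; left; apply/eqP; field.
Qed.

End concentration.

Theorem theorem5p8 (R : realType) (N : nat) (z a : N.-tuple R)
    (ybar : nat -> nat -> R)
    (d : R -> measure_display) (T : forall b : R, measurableType (d b))
    (P : forall b : R, probability (T b) R)
    (Y : forall b : R, {RV (P b) >-> 'C(N, 2).-tuple (measurableTypeR R)})
    (hN : (1 <= N)%N)
    (hz : forall i, (1 <= i < N)%N -> entry z i.+1 < entry z i)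
    (hY : forall b : R, 0 < b ->
      perturbed_corners b (map_tuple (fun x => b / 2 * x) a) z (Y b))
    (hybar : infty_corners a z ybar) :
  forall k i : nat, (1 <= i <= k)%N -> (k <= N)%N ->
    cvg_in_probability P (fun b w => corners_array z (Y b w) k i) (ybar k i).
Proof.
move=> k i ik kN eps eps0; have [yN inter crit] := hybar.
have sy : strict_array N ybar.
  move=> j jN l lj; have [/(_ l lj)/andP[h1 h2] ne] := inter j jN.
  rewrite !lt_neqAle h1 h2 !andbT; apply/andP; split; apply/eqP.
    by move/esym; apply: ne; lia.
  by apply: ne; lia.
have h4 := hY 4 ltac:(by rewrite ltr0n).
have [|M [kappa [kappa0 hM]]] := deviation_le hN ik kN eps0 sy crit yN.
  by exists (d 4), (T 4), (P 4), (Y 4).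
apply: (@squeeze_cvge _ _ _ _ (cst 0%E) _
  (fun b => (M * expR (- (kappa * b)))%:E)).
- near=> b; rewrite measure_ge0/=.
  have b4 : 4 <= b by near: b; apply: nbhs_pinfty_ge; rewrite num_real.
  by apply: (hM b) => //; apply: hY; apply: lt_le_trans b4; rewrite ltr0n.
- exact: cvg_cst.
- apply: cvg_EFin; first by near=> b.
  rewrite -[X in _ --> X](mulr0 M); apply: cvgM; first exact: cvg_cst.
  apply: (@cvg_comp _ _ _ (fun b => kappa * b) (fun x => expR (- x)) _ (+oo)%R).
    by apply: gt0_cvgMry.
  exact: cvgr_expR.
Unshelve. all: by end_near.
Qed.
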